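(* Let $F:\mathbb{P}^2\dashrightarrow\mathbb{P}^2$ be the rational map $F([z_0:z_1:z_2])=[z_0(z_0^2-z_1^2-z_2^2): z_1^2z_2: z_2(z_0^2-z_2^2)]$ associated with the infinite dihedral group $D_\infty$ through the self-similarity of its Koopman representation $\pi$ on the rooted binary tree. Let $E$ be the extended indeterminacy set of $F$, let $p(A_\pi)\subset\mathbb{P}^2$ be the projective spectrum of $D_\infty$ with respect to $\pi$, and let $\mathcal{J}(F)$ be the Julia set of $F$. Then $\mathcal{J}(F)=p(A_\pi)\cup E$.
   Context: $\mathbb{P}^2$ is the complex projective plane with the Fubini–Study metric. Koopman representation and projective spectrum. $D_\infty=\langle a,t\mid a^2=t^2=1\rangle$ acts on the infinite rooted binary tree, whose boundary is $\partial T=\{0,1\}^{\mathbb{N}}$ with the uniform Bernoulli probability measure $\mu$, by $a(0w)=1w$, $a(1w)=0w$, $t(0w)=0\,a(w)$, $t(1w)=1\,t(w)$. The Koopman representation $\pi$ on $L^2(\partial T,\mu)$ is $(\pi(g)f)(x)=f(g^{-1}x)$. Put $A_\pi(z)=z_0I+z_1\pi(a)+z_2\pi(t)$ and $p(A_\pi)=\{z\in\mathbb{P}^2\mid A_\pi(z)\text{ is not invertible}\}$. It is known (Grigorchuk–Yang) that $p(A_\pi)=\bigcup_{-1\le x\le 1}\{z\in\mathbb{P}^2\mid z_0^2-z_1^2-z_2^2-2z_1z_2x=0\}$. Indeterminacy. The indeterminacy set $I=I_1$ of $F$ is the set of points of $\mathbb{P}^2$ where the three coordinate polynomials of $F$ vanish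 simultaneously. For $n\ge1$, the indeterminacy set $I_n$ of the iterate $F^{\circ n}$ is the set of $p\in\mathbb{P}^2$ for which there is $1\le k\le n$ such that $p,F(p),\dots,F^{\circ(k-2)}(p)\notin I$ and $F^{\circ(k-1)}(p)\in I$. Let $I_\infty=\bigcup_{n\ge1}I_n$; the extended indeterminacy set is $E=\overline{I_\infty}$ (closure in the Fubini–Study metric). Fatou and Julia sets. A point $p\in\mathbb{P}^2\setminus E$ is a Fatou point of $F$ if for every $\epsilon>0$ there is a neighborhood $U$ of $p$ with $\operatorname{diam}F^{\circ n}(U\setminus E)<\epsilon$ for all $n$ (diameter in the Fubini–Study metric). The Fatou set $\mathcal{F}(F)$ is the set of Fatou points and the Julia set is $\mathcal{J}(F)=\mathbb{P}^2\setminus\mathcal{F}(F)$. *)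

(* Defs.v *)
From HB Require Import structures.
From mathcomp Require Import all_boot all_order all_algebra.
From mathcomp Require Import all_classical all_reals all_analysis.
From mathcomp Require Import sesquilinear spectral complex ring.

Set Implicit Arguments.
Unset Strict Implicit.
Unset Printing Implicit Defensive.

Import Order.TTheory GRing.Theory Num.Theory.
Import numFieldNormedType.Exports.

Local Open Scope classical_set_scope.
Local Open Scope ring_scope.

Section HermitianCosine.
Variables (C : numClosedFieldType) (n : nat).
Implicit Types u v w : 'rV[C]_n.
Local Notation "''[' u , v ]" := (dotmx u v) : ring_scope.
Local Notation "''[' u ]" := '[u, u] : ring_scope.

(* cosine of the angle between the complex lines spanned by u and v *)
Definition line_cos u v : C := `|'[u, v]| / (sqrtC '[u] * sqrtC '[v]).

Let unitv u := (sqrtC '[u])^-1 *: u.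

Let dotC u v : '[u, v] = ('[v, u])^*.
Proof. by rewrite (hermC (@dotmx _ _)) expr0 mul1r. Qed.

Let unitvP u : u != 0 -> '[unitv u] = 1.
Proof.
move=> u0; have d0 : 0 < '[u] by rewrite dnorm_gt0.
rewrite /unitv dnormZ ger0_norm ?invr_ge0 ?sqrtC_ge0 ?ltW// exprVn sqrtCK.
by rewrite mulVf ?gt_eqF.
Qed.

Let line_cosE u v : line_cos u v = `|'[unitv u, unitv v]|.
Proof.
have s0 w : 0 <= (sqrtC '[w])^-1 by rewrite invr_ge0 sqrtC_ge0 dnorm_ge0.
rewrite /line_cos /unitv linearZl_LR linearZr_LR/= !normrM norm_conjC !(ger0_norm (s0 _)).
by rewrite invfM [LHS]mulrC mulrA.
Qed.

Lemma line_cos_ge0 u v : 0 <= line_cos u v.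
Proof. by rewrite line_cosE. Qed.

Lemma line_cosC u v : line_cos u v = line_cos v u.
Proof. by rewrite /line_cos dotC norm_conjC [X in _ / X]mulrC. Qed.

Lemma line_cosZ a b u v : a != 0 -> b != 0 ->
  line_cos (a *: u) (b *: v) = line_cos u v.
Proof.
move=> a0 b0; rewrite /line_cos !dnormZ linearZl_LR linearZr_LR/=.
have sqrtZ c w : sqrtC (`|c| ^+ 2 * '[w]) = `|c| * sqrtC '[w].
  by rewrite sqrtCM ?nnegrE ?exprn_ge0 ?dnorm_ge0// sqrCK.
rewrite !sqrtZ !normrM norm_conjC mulrACA mulrA -mulf_div divff ?mul1r//.
by rewrite mulf_neq0 ?normr_eq0.
Qed.

Let CS u v :
  `|'[u, v]| <= sqrtC '[u] * sqrtC '[v] ?= iff ~~ free [:: u; v].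
Proof. exact: CauchySchwarz_sqrt. Qed.

Let dotB u v : '[u - v] = '[u] + '[v] - ('[u, v] + ('[u, v])^*).
Proof. exact: dnormB. Qed.

Let dotBl u v w : '[u - v, w] = '[u, w] - '[v, w].
Proof. exact: linearBl. Qed.

Let dotBr u v w : '[w, u - v] = '[w, u] - '[w, v].
Proof. exact: linearBr. Qed.

Let dotZl a u v : '[a *: u, v] = a * '[u, v].
Proof. by rewrite linearZl_LR. Qed.

Let dotZr a u v : '[u, a *: v] = a^* * '[u, v].
Proof. by rewrite linearZr_LR. Qed.

Let dotZ a u : '[a *: u] = `|a| ^+ 2 * '[u].
Proof. exact: dnormZ. Qed.

Lemma line_cosvv u : u != 0 -> line_cos u u = 1.
Proof. by move=> u0; rewrite line_cosE unitvP// normr1. Qed.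

Lemma line_cos_le1 u v : u != 0 -> v != 0 -> line_cos u v <= 1.
Proof.
move=> u0 v0; rewrite line_cosE (le_trans (CS _ _).1)//.
by rewrite !unitvP// sqrtC1 mulr1.
Qed.

Lemma line_cos_eq1 u v : u != 0 -> v != 0 -> line_cos u v = 1 ->
  exists2 c, c != 0 & v = c *: u.
Proof.
move=> u0 v0; rewrite /line_cos => uv1.
have s0 w : w != 0 -> sqrtC '[w] != 0 by rewrite sqrtC_eq0 dnorm_eq0.
have : `|'[u, v]| == sqrtC '[u] * sqrtC '[v].
  by rewrite -[eqbRHS]mul1r -uv1 divfK// mulf_neq0 ?s0.
rewrite (CS u v).2 free_cons seq1_free v0 andbT negbK.
rewrite span_seq1 => /vlineP[c uE].
have c0 : c != 0 by apply: contraNneq u0 => c0; rewrite uE c0 scale0r.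
by exists c^-1; rewrite ?invr_eq0// uE scalerA mulVf// scale1r.
Qed.

Lemma line_cos_triangle u v w (s t : C) : u != 0 -> v != 0 -> w != 0 ->
    0 <= s -> 0 <= t ->
    s ^+ 2 = 1 - line_cos u v ^+ 2 -> t ^+ 2 = 1 - line_cos v w ^+ 2 ->
  line_cos u v * line_cos v w <= line_cos u w + s * t.
Proof.
move=> u0 v0 w0 s0 t0; rewrite !line_cosE.
have := unitvP u0; have := unitvP v0; have := unitvP w0.
move: (unitv u) (unitv v) (unitv w) => x y z zz yy xx.
set a := '[x, y]; set b := '[y, z] => sE tE.
pose x' := x - a *: y; pose z' := z - b^* *: y.
have dx : '[x'] = s ^+ 2.
  rewrite sE dotB dotZ yy xx dotZr -/a mulr1.
  by rewrite rmorphM/= conjCK normCK; ring.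
have dz : '[z'] = t ^+ 2.
  rewrite tE dotB dotZ yy zz dotZr mulr1 conjCK dotC -/b.
  by rewrite rmorphM/= conjCK norm_conjC normCK; ring.
have abE : '[x, z] = a * b + '[x', z'].
  rewrite dotBl !dotBr !(dotZl, dotZr).
  by rewrite yy conjCK -/a -/b; ring.
have le_st : `|'[x', z']| <= s * t.
  rewrite (le_trans (CS _ _).1)// dx dz !sqrCK//.
have -> : `|a| * `|b| = `|'[x, z] - '[x', z']|.
  by rewrite abE addrK normrM.
by rewrite (le_trans (ler_normB _ _))// lerD2l.
Qed.

End HermitianCosine.

Section ProjectivePlane.
Variable R : realType.

Definition nzvec := {v : 'rV[R[i]]_3 | v != 0}.

Definition same_line (u v : nzvec) : bool :=
  `[< exists2 c : R[i], c != 0 & val v = c *: val u >].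

Lemma same_line_refl : reflexive same_line.
Proof. by move=> u; apply/asboolP; exists 1; rewrite ?oner_neq0 ?scale1r. Qed.

Lemma same_line_sym : symmetric same_line.
Proof.
suff H u v : same_line u v -> same_line v u.
  by move=> u v; apply/idP/idP; exact: H.
move=> /asboolP[c c0 vE]; apply/asboolP; exists c^-1; first by rewrite invr_eq0.
by rewrite vE scalerA mulVf// scale1r.
Qed.

Lemma same_line_trans : transitive same_line.
Proof.
move=> v u w /asboolP[c c0 vE] /asboolP[d d0 wE]; apply/asboolP.
by exists (d * c); [rewrite mulf_neq0|rewrite wE vE scalerA].
Qed.

Canonical same_line_equiv :=
  EquivRel same_line same_line_refl same_line_sym same_line_trans.

Definition P2 : Type := {eq_quot same_line}%qT.
HB.instance Definition _ := Choice.on P2.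
HB.instance Definition _ := EqQuotient.on P2.

(* homogeneous coordinates of p, chosen among all proportional ones *)
Definition hcoord (p : P2) : 'rV[R[i]]_3 := val (repr p).

Lemma hcoord_neq0 p : hcoord p != 0.
Proof. exact: (valP (repr p)). Qed.

Lemma hcoord_pi (v : nzvec) :
  exists2 c : R[i], c != 0 & hcoord (\pi_P2 v)%qT = c *: val v.
Proof.
have /eqmodP : (v = repr (\pi_P2 v) %[mod P2])%qT by rewrite reprK.
by move=> /asboolP.
Qed.

Lemma hcoord_inj (p q : P2) (c : R[i]) :
  c != 0 -> hcoord q = c *: hcoord p -> p = q.
Proof.
move=> c0 qE; rewrite -(reprK p) -(reprK q); apply/eqmodP/asboolP.
by exists c.
Qed.

(* Fubini-Study distance, normalized to diameter pi / 2; line_cos takes real  *)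
(* values, so that Re merely changes the type.                                *)
Definition fs_dist (p q : P2) : R :=
  acos (complex.Re (line_cos (hcoord p) (hcoord q))).

Let fs_cos p q := complex.Re (line_cos (hcoord p) (hcoord q)).

Let fs_cosE p q : ((fs_cos p q)%:C)%C = line_cos (hcoord p) (hcoord q).
Proof. exact: RRe_real (ger0_real (line_cos_ge0 _ _)). Qed.

Let fs_cos_itv p q : 0 <= fs_cos p q <= 1.
Proof.
by rewrite -!lecR fs_cosE line_cos_ge0 line_cos_le1 ?hcoord_neq0.
Qed.

Let fs_cos_itvN p q : -1 <= fs_cos p q <= 1.
Proof.
by have /andP[p0 ->] := fs_cos_itv p q; rewrite (le_trans _ p0)// lerN10.
Qed.

Lemma fs_distxx p : fs_dist p p = 0.
Proof. by rewrite /fs_dist line_cosvv ?hcoord_neq0//= acos1. Qed.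

Lemma fs_dist_positivity p q : fs_dist p q = 0 -> p = q.
Proof.
move=> pq0; have pq1 : fs_cos p q = 1.
  by rewrite -(@acosK _ (fs_cos p q)) ?in_itv//= [acos _]pq0 cos0.
have [] := @line_cos_eq1 _ _ (hcoord p) (hcoord q); rewrite ?hcoord_neq0//.
  by rewrite -fs_cosE pq1.
by move=> c c0; exact: hcoord_inj.
Qed.

Lemma fs_dist_sym p q : fs_dist p q = fs_dist q p.
Proof. by rewrite /fs_dist line_cosC. Qed.

Let acos_triangle (a b c : R) : 0 <= a <= 1 -> 0 <= b <= 1 -> 0 <= c <= 1 ->
  a * b <= c + Num.sqrt (1 - a ^+ 2) * Num.sqrt (1 - b ^+ 2) ->
  acos c <= acos a + acos b.
Proof.
have itvN (x : R) : 0 <= x <= 1 -> -1 <= x <= 1.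
  by move=> /andP[x0 ->]; rewrite (le_trans _ x0)// lerN10.
have acos_pi2 (x : R) : 0 <= x <= 1 -> acos x <= pi / 2.
  move=> x01; have x11 := itvN _ x01.
  rewrite leNgt; apply/negP => lt_pi.
  have : cos (acos x) < cos (pi / 2).
    rewrite ltr_cos// in_itv/= ?acos_ge0 ?acos_lepi//.
    by rewrite divr_ge0 ?pi_ge0//= ler_pdivrMr// ler_peMr ?pi_ge0// ler1n.
  by rewrite cos_pihalf acosK ?in_itv//= ltNge; case/andP: x01 => ->.
move=> a01 b01 c01 abc.
have a11 := itvN _ a01; have b11 := itvN _ b01; have c11 := itvN _ c01.
have itvD : acos a + acos b \in `[0, pi].
  rewrite in_itv/=; apply/andP; split; first by apply: addr_ge0; exact: acos_ge0.
  by rewrite [X in _ <= X](splitr pi); apply: lerD; exact: acos_pi2.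
rewrite leNgt -ltr_cos//; last by rewrite in_itv/= acos_ge0 ?acos_lepi.
by rewrite -leNgt cosD !sin_acos// !acosK ?in_itv//= lerBlDr.
Qed.

Lemma fs_dist_triangle q p r : fs_dist p r <= fs_dist p q + fs_dist q r.
Proof.
apply: (acos_triangle (fs_cos_itv p q) (fs_cos_itv q r) (fs_cos_itv p r)).
have := fun s t => @line_cos_triangle _ _ _ _ _ s t
  (hcoord_neq0 p) (hcoord_neq0 q) (hcoord_neq0 r).
rewrite -!fs_cosE; move: (fs_cos_itv p q) (fs_cos_itv q r).
move: (fs_cos p q) (fs_cos q r) (fs_cos p r) => a b c a01 b01.
have sq (x : R) : 0 <= x <= 1 -> 0 <= 1 - x ^+ 2.
  by move=> /andP[x0 x1]; rewrite subr_ge0 expr_le1.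
have sqC (x : R) : 0 <= x <= 1 ->
    ((Num.sqrt (1 - x ^+ 2))%:C)%C ^+ 2 = 1 - ((x%:C)%C) ^+ 2 :> R[i].
  by move=> /sq x1; rewrite -(rmorphXn (real_complex R))/= sqr_sqrtr// rmorphB rmorphXn.
move=> /(_ (Num.sqrt (1 - a ^+ 2))%:C%C (Num.sqrt (1 - b ^+ 2))%:C%C).
rewrite !lecR !sqrtr_ge0 => /(_ isT isT (sqC _ a01) (sqC _ b01)).
by rewrite -!(rmorphM (real_complex R)) -(rmorphD (real_complex R)) lecR.
Qed.

HB.instance Definition _ := isMetric.Build R P2
  fs_distxx fs_dist_positivity fs_dist_sym fs_dist_triangle.

Lemma fs_mdistE (p q : P2) : mdist p q = fs_dist p q.
Proof. by []. Qed.

End ProjectivePlane.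

Definition diam (K : realType) (M : metricType K) (A : set M) : \bar K :=
  ereal_sup [set (mdist xy.1 xy.2)%:E | xy in A `*` A].

Section RationalMap.
Variable R : realType.

Definition F_poly (z : 'rV[R[i]]_3) : 'rV[R[i]]_3 :=
  let z0 := z 0 0 in let z1 := z 0 1 in let z2 := z 0 2 in
  \row_i [:: z0 * (z0 ^+ 2 - z1 ^+ 2 - z2 ^+ 2);
             z1 ^+ 2 * z2;
             z2 * (z0 ^+ 2 - z2 ^+ 2)]`_i.

Definition indet : set (P2 R) := [set p | F_poly (hcoord p) = 0].

(* On indet, where F is undefined, the value F p = p is meaningless; every    *)
(* use of F and of its iterates below stays away from such points.            *)
Definition F (p : P2 R) : P2 R :=
  if insub (F_poly (hcoord p)) is Some v then (\pi_(P2 R) (v : nzvec R))%qT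
  else p.

Lemma F_polyZ c z : F_poly (c *: z) = c ^+ 3 *: F_poly z.
Proof.
apply/rowP => i; rewrite !mxE.
by case: i => -[|[|[|//]]] ?/=; ring.
Qed.

Lemma indet_pi (v : nzvec R) : indet (\pi v)%qT <-> F_poly (val v) = 0.
Proof.
have [c c0] := hcoord_pi v; rewrite /indet/= => ->; rewrite F_polyZ.
split=> [/eqP|->]; last by rewrite scaler0.
by rewrite scaler_eq0 expf_eq0/= (negPf c0) => /eqP.
Qed.

Lemma F_pi (v w : nzvec R) : val w = F_poly (val v) -> F (\pi v)%qT = (\pi w)%qT.
Proof.
move=> wE; have [c c0 vE] := hcoord_pi v; rewrite /F vE F_polyZ -wE.
have c30 : c ^+ 3 != 0 by rewrite expf_eq0.
case: insubP => [u _ uE|]; last first.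
  by rewrite scaler_eq0 negb_or c30 (valP w).
apply/eqmodP/asboolP; exists (c ^+ 3)^-1; first by rewrite invr_eq0.
by rewrite uE scalerA mulVf// scale1r.
Qed.

Definition indet_iter (n : nat) : set (P2 R) :=
  [set p | exists k, [/\ (1 <= k <= n)%N,
     forall j, (j.+1 < k)%N -> ~ indet (iter j F p) &
     indet (iter k.-1 F p)]].

Definition ext_indet : set (P2 R) :=
  closure (\bigcup_(n in [set n | (1 <= n)%N]) indet_iter n).

Definition fatou_point (p : P2 R) : Prop :=
  ~ ext_indet p /\
  forall e : R, 0 < e -> exists2 U : set (P2 R), nbhs p U &
    forall n, (diam (iter n F @` (U `\` ext_indet)) < e%:E)%E.

Definition fatou_set : set (P2 R) := [set p | fatou_point p].

Definition julia_set : set (P2 R) := ~` fatou_set.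

End RationalMap.

Arguments indet : clear implicits.
Arguments indet_iter : clear implicits.
Arguments ext_indet : clear implicits.
Arguments fatou_set : clear implicits.
Arguments julia_set : clear implicits.

(* A word in the generators a (encoded by false) and t (encoded by true) is   *)
(* reduced when no two adjacent letters are equal; reduced words are the      *)
(* normal forms of the presentation <a, t | a^2 = t^2 = 1>.                   *)
Definition reduced (w : seq bool) := sorted (fun b c => b != c) w.

Definition Dinf := {w : seq bool | reduced w}.

Section DihedralGroup.

Let push (b : bool) (w : seq bool) : seq bool :=
  if w is c :: w' then if b == c then w' else b :: w else [:: b].

Let push_reduced b w : reduced w -> reduced (push b w).
Proof.
case: w => //= c w; have [_|bc] := eqVneq b c; first exact: path_sorted.
by rewrite /= bc.
Qed.

Let pushK b w : reduced w -> push b (push b w) = w.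
Proof.
case: w => [|c w]/=; first by rewrite eqxx.
have [->|bc _] := eqVneq b c; last by rewrite /= eqxx.
by case: w => //= d w /andP[/negPf->].
Qed.

Let mulw (v w : seq bool) := foldr push w v.

Let mulw_reduced v w : reduced w -> reduced (mulw v w).
Proof. by move=> rw; elim: v => //= b v; exact: push_reduced. Qed.

Let mulw_push b v w : reduced w -> mulw (push b v) w = push b (mulw v w).
Proof.
case: v => //= c v rw; have [->|//] := eqVneq b c.
by rewrite pushK// mulw_reduced.
Qed.

Let mulwA u v w : reduced w -> mulw u (mulw v w) = mulw (mulw u v) w.
Proof. by move=> rw; elim: u => //= b u ->; rewrite mulw_push. Qed.

Let mulw_nil w : reduced w -> mulw w [::] = w.
Proof.
elim: w => //= b w IH bw; rewrite IH; last exact: path_sorted bw.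
by case: w bw {IH} => //= c w /andP[/negPf->].
Qed.

Let rev_reduced w : reduced w -> reduced (rev w).
Proof. by rewrite /reduced rev_sorted; under eq_sorted do rewrite eq_sym. Qed.

Let mulw_cat u v w : mulw (u ++ v) w = mulw u (mulw v w).
Proof. exact: foldr_cat. Qed.

Let mulVw w : mulw (rev w) w = [::].
Proof.
elim: w => // b w IH; rewrite rev_cons -cats1 mulw_cat/=.
by rewrite eqxx.
Qed.

Definition Dinf_one : Dinf := exist _ [::] isT.
Definition Dinf_mul (g h : Dinf) : Dinf :=
  exist _ (mulw (val g) (val h)) (mulw_reduced (val g) (valP h)).
Definition Dinf_inv (g : Dinf) : Dinf :=
  exist _ (rev (val g)) (rev_reduced (valP g)).

Let Dinf_mulA : associative Dinf_mul.
Proof. by move=> g h k; apply/val_inj/mulwA/(valP k). Qed.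

Let Dinf_mul1 : left_id Dinf_one Dinf_mul.
Proof. by move=> g; exact/val_inj. Qed.

Let Dinf_mulg1 : right_id Dinf_one Dinf_mul.
Proof. by move=> g; apply/val_inj/mulw_nil/(valP g). Qed.

Let Dinf_mulV : left_inverse Dinf_one Dinf_inv Dinf_mul.
Proof. by move=> g; apply/val_inj/mulVw. Qed.

Let Dinf_mulgV : right_inverse Dinf_one Dinf_inv Dinf_mul.
Proof.
move=> g; apply: val_inj => /=; rewrite -{1}(revK (val g)); exact: mulVw.
Qed.

HB.instance Definition _ := Choice.on Dinf.
HB.instance Definition _ :=
  isGroup.Build Dinf Dinf_mulA Dinf_mul1 Dinf_mulg1 Dinf_mulV Dinf_mulgV.

End DihedralGroup.

Definition Dinf_a : Dinf := exist _ [:: false] isT.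
Definition Dinf_t : Dinf := exist _ [:: true] isT.

Lemma Dinf_aa : (Dinf_a * Dinf_a = 1)%g. Proof. exact: val_inj. Qed.
Lemma Dinf_tt : (Dinf_t * Dinf_t = 1)%g. Proof. exact: val_inj. Qed.

(* The letters 0 and 1 of the binary alphabet are false and true. *)
Definition bcons (b : bool) (w : nat -> bool) : nat -> bool :=
  fun n => if n is m.+1 then w m else b.

Definition bshift (x : nat -> bool) : nat -> bool := fun n => x n.+1.

Definition act_a (x : nat -> bool) : nat -> bool := bcons (~~ x 0%N) (bshift x).

(* The recursion t(0w) = 0a(w), t(1w) = 1t(w) determines t(x) letter by       *)
(* letter: the n-th letter of t(x) is computed by recursion on n.             *)
Fixpoint act_t_letter (n : nat) (x : nat -> bool) : bool :=
  if n is m.+1 then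
    if x 0%N then act_t_letter m (bshift x) else act_a (bshift x) m
  else x 0%N.

Definition act_t (x : nat -> bool) : nat -> bool := act_t_letter^~ x.

Lemma act_a0 w : act_a (bcons false w) = bcons true w.
Proof. by []. Qed.
Lemma act_a1 w : act_a (bcons true w) = bcons false w.
Proof. by []. Qed.
Lemma act_t0 w : act_t (bcons false w) = bcons false (act_a w).
Proof. by apply/funext => -[]. Qed.
Lemma act_t1 w : act_t (bcons true w) = bcons true (act_t w).
Proof. by apply/funext => -[]. Qed.

Definition Dinf_act (g : Dinf) (x : nat -> bool) : nat -> bool :=
  foldr (fun b : bool => if b then act_t else act_a) x (val g).

Lemma bconsE x : bcons (x 0%N) (bshift x) = x.
Proof. by apply/funext => -[]. Qed.

Lemma act_aK : involutive act_a.
Proof. by move=> x; rewrite /act_a/= negbK; exact: bconsE. Qed.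

Lemma act_tK : involutive act_t.
Proof.
move=> x; apply/funext => n; elim: n x => // n IH x.
rewrite -(bconsE x); case: (x 0%N); first by rewrite !act_t1; exact: IH.
by rewrite !act_t0 act_aK.
Qed.

Lemma Dinf_act1 x : Dinf_act 1%g x = x.
Proof. by []. Qed.

Lemma Dinf_actM (g h : Dinf) x :
  Dinf_act (g * h)%g x = Dinf_act g (Dinf_act h x).
Proof.
rewrite /Dinf_act/=; elim: (val g) => //= b w <-.
case: (foldr _ _ w) => //= c v; have [->|//] := eqVneq b c.
by case: c; rewrite /= ?act_tK ?act_aK.
Qed.

Definition cylinder (u : seq bool) : set (nat -> bool) :=
  [set x | forall i, (i < size u)%N -> x i = nth false u i].

Definition boundary := g_sigma_algebraType (range cylinder).
HB.instance Definition _ := Measurable.on boundary.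

Definition uniform_bernoulli (R : realType) (mu : probability boundary R) : Prop :=
  forall u : seq bool, mu (cylinder u) = ((2 ^- size u)%:E)%E.

Section ComplexL2.
Context d (T : measurableType d) (R : realType).
Variable mu : {measure set T -> \bar R}.
Implicit Types (f g : T -> R[i]) (A B : (T -> R[i]) -> (T -> R[i])).

Definition L2norm f : \bar R :=
  Lnorm mu 2%:E (fun x => (Normc.normc (f x))%:E).

Definition L2 : set (T -> R[i]) :=
  [set f | [/\ measurable_fun setT (fun x => complex.Re (f x)),
               measurable_fun setT (fun x => complex.Im (f x)) &
               (L2norm f < +oo)%E]].

(* Elements of the Hilbert space L^2(mu) are represented by square-integrable *)
(* functions, two of which are identified when they are equal mu-almost       *)
(* everywhere. Linearity and boundedness imply compatibility with this        *)
(* identification.                                                            *)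
Definition bounded_operator A : Prop :=
  [/\ forall f, L2 f -> L2 (A f),
      forall (c : R[i]) f g, L2 f -> L2 g ->
        A (fun x => c * f x + g x) = (fun x => c * A f x + A g x) %[ae mu] &
      exists M : R, forall f, L2 f -> (L2norm (A f) <= M%:E * L2norm f)%E].

Definition invertible_operator A : Prop :=
  exists B, bounded_operator B /\
    forall f, L2 f -> A (B f) = f %[ae mu] /\ B (A f) = f %[ae mu].

End ComplexL2.

Section KoopmanSpectrum.
Variable R : realType.

Definition koopman (g : Dinf) (f : boundary -> R[i]) : boundary -> R[i] :=
  fun x => f (Dinf_act g^-1%g x).

Definition A_pi (z : 'rV[R[i]]_3) (f : boundary -> R[i]) : boundary -> R[i] :=
  fun x => z 0 0 * f x + z 0 1 * koopman Dinf_a f x + z 0 2 * koopman Dinf_t f x.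

Definition proj_spectrum (mu : probability boundary R) : set (P2 R) :=
  [set z | ~ invertible_operator mu (A_pi (hcoord z))].

End KoopmanSpectrum.

(* Main.v *)
Require Import Defs.
From mathcomp Require Import all_boot all_order all_algebra.
From mathcomp Require Import all_classical all_reals all_analysis.
From mathcomp Require Import measurable_realfun.
From mathcomp Require Import sesquilinear spectral complex ring lra.

(** Let Q = z0^2 - z1^2 - z2^2. The spectrum is the union of the conics
    Q = 2 z1 z2 x with x in [-1, 1], and the key to both halves of the theorem
    is the Joukowski parameter: every z has an m with |m| <= 1 and a k such that
    z1 z2 = k m and Q = k (1 + m^2) ([joukowski_exists]), and z lies on one of
    the conics as soon as |m| = 1 ([joukowski_unit]).

    The parameter linearizes F. With N = 2^n, the n-th iterate of z is
      [z0 (1 - m^(2N)) : z1 (1 - m^2) m^(N-1)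
                       : z2 + m z1 - m^(2N-1) (m z2 + z1)]
    as long as no iterate is indeterminate ([coords_iter]): F squares m and
    keeps (z2 + m z1) / z0. If |m| < 1, these vectors depend on z in a Lipschitz
    way uniformly in n and stay away from 0, except when z0 = z2 + m z1 = 0; but
    then z is a limit of points whose orbits meet the indeterminacy set
    ([degenerate_ext_indet]). So points off the conics and off E are Fatou
    points ([fatou_off_spectrum]). Near a point of a conic there are points
    whose m is a root of unity of order a power of 2, which eventually land on
    [0 : 1 : -1], and points with |m| < 1, which are attracted by the line
    z1 = 0; hence it is not a Fatou point ([not_fatou_on_spectrum]).

    The same parameter decides invertibility. With z' = (z0, -z1, -z2) and the
    unitary U of the rotation a t, the operators of z and z' commute and their
    product is k (1 - m U) (1 - m U^-1); for |m| < 1 both factors have Neumann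
    series ([invertible_off_conics]). Conversely the functions [chi] of level n
    with w^(2^n) = 1 span, with their conjugates, planes on which the operator
    is a 2 x 2 matrix of determinant Q - 2 z1 z2 Re w. The numbers Re w are
    dense in [-1, 1], so on the conics the operator is not bounded below
    ([singular_on_conics]). *)

Set Implicit Arguments.
Unset Strict Implicit.
Unset Printing Implicit Defensive.

Import Order.TTheory GRing.Theory Num.Theory.
Import numFieldNormedType.Exports.
Import Normc.

Local Open Scope classical_set_scope.
Local Open Scope ring_scope.

(** * Moduli of complex numbers *)

Section ComplexModulus.
Variable R : realType.
Implicit Types x y z : R[i].

Lemma normcE z : (normc z)%:C%C = `|z|.
Proof. by rewrite normc_def; case: z. Qed.

Lemma normc_one : normc (1 : R[i]) = 1.
Proof. exact: normc1. Qed.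

Lemma normc_ge0 z : 0 <= normc z.
Proof. by rewrite -ler0c normcE. Qed.

Lemma normc_gt0 z : z != 0 -> 0 < normc z.
Proof. by move=> z0; rewrite -ltcR normcE normr_gt0. Qed.

Lemma normcX z n : normc (z ^+ n) = normc z ^+ n.
Proof.
elim: n => [|n IH]; first by rewrite !expr0 normc1.
by rewrite !exprS normcM IH.
Qed.

Lemma le_normcB x y : normc (x - y) <= normc x + normc y.
Proof. by rewrite -[normc y]normcN le_normcD. Qed.

Lemma normc_distC x y : normc (x - y) = normc (y - x).
Proof. by rewrite -normcN opprB. Qed.

Lemma normc_sqE z : normc z ^+ 2 = complex.Re z ^+ 2 + complex.Im z ^+ 2.
Proof. by case: z => a b /=; rewrite sqr_sqrtr// addr_ge0 ?sqr_ge0. Qed.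

Lemma normc_conj z : normc (z^*)%C = normc z.
Proof. by case: z => a b /=; rewrite sqrrN. Qed.

Lemma normc_real (a : R) : normc (a%:C)%C = `|a|.
Proof. by rewrite /= expr0n addr0 sqrtr_sqr. Qed.

End ComplexModulus.

(** * Coordinates of projective points and the Fubini-Study distance *)

Section LineDistance.
Variables (C : numClosedFieldType) (n : nat).
Implicit Types u v w : 'rV[C]_n.
Local Notation "''[' u , v ]" := (dotmx u v) : ring_scope.
Local Notation "''[' u ]" := '[u, u] : ring_scope.

Lemma dotmxC u v : '[u, v] = ('[v, u])^*.
Proof. by rewrite (hermC (@dotmx _ _)) expr0 mul1r. Qed.

Lemma dotmxB u v : '[u - v] = '[u] + '[v] - ('[u, v] + ('[u, v])^*).
Proof. exact: dnormB. Qed.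

Lemma line_cos_sq u v : u != 0 -> v != 0 ->
  line_cos u v ^+ 2 = '[u, v] * '[u, v]^* / ('[u] * '[v]).
Proof.
by move=> u0 v0; rewrite /line_cos expr_div_n exprMn !sqrtCK normCK.
Qed.

(** The left side is the squared distance from [u] to the line of [v], so it
    is at most the squared distance from [u] to the point [v] of that line;
    the difference of the two is [`|'[v] - '[u, v]| ^+ 2 / '[v]]. *)
Lemma dist_line_ge u v : u != 0 -> v != 0 ->
  '[u] * (1 - line_cos u v ^+ 2) <= '[v - u].
Proof.
move=> u0 v0; rewrite line_cos_sq// dotmxB (dotmxC v u) conjCK.
have : 0 <= `|'[v] - '[u, v]| ^+ 2 / '[v].
  by rewrite mulr_ge0 ?exprn_ge0 ?invr_ge0 ?dnorm_ge0.
rewrite normCK rmorphB/= -(dotmxC v v).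
have : '[u] != 0 by rewrite dnorm_eq0.
have : '[v] != 0 by rewrite dnorm_eq0.
move: '[u] '[v] '[u, v] => U V b V0 U0; rewrite -[in X in _ -> X]subr_ge0.
by congr (_ <= _); field; rewrite V0.
Qed.

(** The orthogonal projection of [v] onto the line of [u] realizes the
    distance from [v] to that line. *)
Lemma dist_line_proj u v : u != 0 -> v != 0 ->
  '['[v, u] / '[u] *: u - v] = '[v] * (1 - line_cos v u ^+ 2).
Proof.
move=> u0 v0; rewrite line_cos_sq//.
have -> : '['[v, u] / '[u] *: u - v] = `|'[v, u] / '[u]| ^+ 2 * '[u] + '[v] -
    ('[v, u] / '[u] * '[u, v] + ('[v, u] / '[u] * '[u, v])^*).
  by rewrite -dnormZ -linearZl_LR; exact: dotmxB.
rewrite normCK (dotmxC u v) !rmorphM/= fmorphV/= conjCK -(dotmxC u u).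
have : '[u] != 0 by rewrite dnorm_eq0.
have : '[v] != 0 by rewrite dnorm_eq0.
move: '[u] '[v] '[v, u] => U V b V0 U0.
by field; rewrite ?V0 ?U0.
Qed.

Lemma line_cos_eq0 u v : u != 0 -> v != 0 ->
  '[u, v] = 0 -> line_cos u v = 0.
Proof. by move=> u0 v0 E; rewrite /line_cos E normr0 mul0r. Qed.

End LineDistance.

Section HomogeneousCoordinates.
Variable R : realType.
Local Notation C := R[i].
Implicit Types (u v w : 'rV[C]_3) (p q : P2 R).

Definition vec3 (a b c : C) : 'rV[C]_3 := \row_i [:: a; b; c]`_i.

Lemma vec3E v : v = vec3 (v 0 0) (v 0 1) (v 0 2).
Proof.
apply/rowP => i; rewrite !mxE.
by case: i => -[|[|[|//]]] h /=; congr (v _ _); exact: val_inj.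
Qed.

Lemma vec3_0 a b c : vec3 a b c 0 0 = a. Proof. by rewrite mxE. Qed.
Lemma vec3_1 a b c : vec3 a b c 0 1 = b. Proof. by rewrite mxE. Qed.
Lemma vec3_2 a b c : vec3 a b c 0 2 = c. Proof. by rewrite mxE. Qed.

Definition vnorm2 v : R :=
  normc (v 0 0) ^+ 2 + normc (v 0 1) ^+ 2 + normc (v 0 2) ^+ 2.

Lemma sum3 (V : nmodType) (f : 'I_3 -> V) : \sum_i f i = f 0 + f 1 + f 2.
Proof.
rewrite !big_ord_recl big_ord0 addr0 addrA.
by congr (f _ + f _ + f _); exact: val_inj.
Qed.

Lemma vnorm2E v : (vnorm2 v)%:C%C = dotmx v v.
Proof.
rewrite dotmxE mxE sum3 !mxE -!normCK -!normcE.
by rewrite /vnorm2 !(rmorphD, rmorphXn) /=.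
Qed.

Lemma vnorm2_ge0 v : 0 <= vnorm2 v.
Proof. by rewrite /vnorm2 !addr_ge0 ?sqr_ge0. Qed.

Lemma vnorm2_gt0 v : v != 0 -> 0 < vnorm2 v.
Proof. by move=> v0; rewrite -ltcR vnorm2E dnorm_gt0. Qed.

Lemma vnorm2Z c v : vnorm2 (c *: v) = normc c ^+ 2 * vnorm2 v.
Proof. by rewrite /vnorm2 !mxE !normcM !exprMn; ring. Qed.

Definition line_cosR u v : R := complex.Re (line_cos u v).

Lemma line_cosRE u v : (line_cosR u v)%:C%C = line_cos u v.
Proof. exact: RRe_real (ger0_real (line_cos_ge0 _ _)). Qed.

Lemma line_cosR_ge0 u v : 0 <= line_cosR u v.
Proof. by rewrite -ler0c line_cosRE line_cos_ge0. Qed.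

Lemma line_cosR_le1 u v : u != 0 -> v != 0 -> line_cosR u v <= 1.
Proof. by move=> u0 v0; rewrite -lecR line_cosRE line_cos_le1. Qed.

Lemma vnorm2B_ge u v : u != 0 -> v != 0 ->
  vnorm2 u * (1 - line_cosR u v ^+ 2) <= vnorm2 (v - u).
Proof.
move=> u0 v0; have := dist_line_ge u0 v0; rewrite -!vnorm2E -line_cosRE.
have -> : 1 - (line_cosR u v)%:C%C ^+ 2 = (1 - line_cosR u v ^+ 2)%:C%C :> C.
  by rewrite (rmorphB (real_complex R)) (rmorph1 (real_complex R)) !expr2
    (rmorphM (real_complex R)).
by rewrite -(rmorphM (real_complex R)) lecR.
Qed.

Lemma line_cosR_proj u v : u != 0 -> v != 0 -> 0 < line_cosR v u ->
  exists2 a, a != 0 &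
  vnorm2 (a *: u - v) = vnorm2 v * (1 - line_cosR v u ^+ 2).
Proof.
move=> u0 v0 c0; exists (dotmx v u / dotmx u u).
  rewrite mulf_neq0 ?invr_eq0 ?dnorm_eq0//; apply/eqP => /(line_cos_eq0 v0 u0).
  by rewrite -line_cosRE => -[E]; rewrite E ltxx in c0.
apply: complexI; rewrite vnorm2E dist_line_proj// -vnorm2E -line_cosRE.
by rewrite (rmorphM (real_complex R)) (rmorphB (real_complex R))
  (rmorph1 (real_complex R)) !expr2 (rmorphM (real_complex R)).
Qed.

(** The representative [hcoord p] is chosen arbitrarily and does not vary
    continuously with [p]; estimates near a point need the freedom to choose
    another one. *)
Definition coords v p := exists2 c : C, c != 0 & v = c *: hcoord p.

Lemma coords_hcoord p : coords (hcoord p) p.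
Proof. by exists 1; rewrite ?oner_neq0 ?scale1r. Qed.

Lemma coords_neq0 v p : coords v p -> v != 0.
Proof. by move=> [c c0 ->]; rewrite scaler_eq0 negb_or c0 hcoord_neq0. Qed.

Lemma coordsZ c v p : c != 0 -> coords v p -> coords (c *: v) p.
Proof.
by move=> c0 [d d0 ->]; exists (c * d); rewrite ?mulf_neq0// scalerA.
Qed.

Lemma coords_inj v w p : coords v p -> coords w p -> exists2 c, c != 0 & w = c *: v.
Proof.
move=> [c c0 ->] [d d0 ->]; exists (d / c).
  by rewrite mulf_neq0 ?invr_eq0.
by rewrite scalerA divfK.
Qed.

Lemma coords_exists v : v != 0 -> exists p, coords v p.
Proof.
move=> v0; pose u : nzvec R := exist _ v v0.
exists (\pi_(P2 R) u)%qT; have [c c0 E] := hcoord_pi u.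
by exists c^-1; rewrite ?invr_eq0// E scalerA mulVf// scale1r.
Qed.

Lemma coords_indet v p : coords v p -> indet R p <-> F_poly v = 0.
Proof.
move=> [c c0 ->]; rewrite F_polyZ /indet/=.
split=> [->|/eqP]; first by rewrite scaler0.
by rewrite scaler_eq0 expf_eq0/= (negPf c0) => /eqP.
Qed.

Lemma coords_F v p : coords v p -> ~ indet R p -> coords (F_poly v) (F p).
Proof.
move=> [c c0 ->] np; rewrite F_polyZ; apply: coordsZ; first by rewrite expf_neq0.
rewrite /F; case: insubP => [u _ uE|]; last by move/negPn/eqP.
rewrite -uE; have [d d0 E] := hcoord_pi u.
by exists d^-1; rewrite ?invr_eq0// E scalerA mulVf// scale1r.
Qed.

Lemma coords_mdist v w p q :
  coords v p -> coords w q -> mdist p q = acos (line_cosR v w).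
Proof.
move=> [c c0 ->] [d d0 ->]; rewrite fs_mdistE /fs_dist /line_cosR.
by rewrite line_cosZ.
Qed.

Lemma line_cosR_itv v w : v != 0 -> w != 0 -> -1 <= line_cosR v w <= 1.
Proof.
by move=> v0 w0; rewrite line_cosR_le1// andbT (le_trans (lerN10 _))// line_cosR_ge0.
Qed.

(** Vectors that are close relative to their length represent close points: if
    f is the minimum of e and pi / 2, lines at an angle at least f force
    [vnorm2 (w - v)] to be at least [vnorm2 v * sin f ^+ 2]. *)
Lemma mdist_lt (e : R) : 0 < e -> exists2 k, 0 < k &
  forall v w p q, coords v p -> coords w q -> vnorm2 (w - v) < k * vnorm2 v ->
  mdist p q < e.
Proof.
move=> e0; pose f := Num.min e (pi / 2).
have pi2 : 0 < pi / 2 :> R by rewrite divr_gt0 ?pi_gt0.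
have f0 : 0 < f by rewrite lt_min e0.
have fpi2 : f <= pi / 2 by rewrite ge_min lexx orbT.
have fpi : f < pi.
  by rewrite (le_lt_trans fpi2)// ltr_pdivrMr// ltr_pMr ?pi_gt0// ltr1n.
exists (sin f ^+ 2); first by rewrite exprn_gt0// sin_gt0_pi// f0.
move=> v w p q vp wq; have v0 := coords_neq0 vp; have w0 := coords_neq0 wq.
apply: contraPT; rewrite -leNgt => ed; apply/negP; rewrite -leNgt.
apply: le_trans (vnorm2B_ge v0 w0); rewrite mulrC ler_pM2l ?vnorm2_gt0//.
rewrite sin2cos2 lerB// lerXn2r ?nnegrE ?line_cosR_ge0//.
  by rewrite cos_ge0_pihalf// fpi2 andbT (le_trans _ (ltW f0))// oppr_le0 ltW.
rewrite -(@acosK _ (line_cosR v w)) ?in_itv/= ?line_cosR_itv// -(coords_mdist vp wq).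
have dI : mdist p q \in `[0, pi].
  by rewrite (coords_mdist vp wq) in_itv/= acos_ge0 ?acos_lepi ?line_cosR_itv.
rewrite leNgt ltr_cos//; first by rewrite -leNgt (le_trans _ ed)// ge_min lexx.
by rewrite in_itv/= !ltW.
Qed.

(** Conversely, projecting [v] onto the line of [q] gives coordinates of [q]
    close to [v]. The bound [e] depends on [v] alone, so that it can be fixed
    before the two points are known. *)
Lemma mdist_near_coords v (d : R) : v != 0 -> 0 < d -> exists2 e, 0 < e &
  forall p q, coords v p -> mdist p q < e ->
  exists2 w, coords w q & vnorm2 (w - v) < d.
Proof.
move=> v0 d0; have v1 := vnorm2_gt0 v0.
pose k := Num.min 1 (d / vnorm2 v).
have k0 : 0 < k by rewrite lt_min ltr01 divr_gt0.
have k1 : k <= 1 by rewrite ge_min lexx.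
have kd : k * vnorm2 v <= d by rewrite -ler_pdivlMr// ge_min lexx orbT.
have cI : -1 <= 1 - k / 2 < 1.
  by apply/andP; split; lra.
exists (acos (1 - k / 2)); first by rewrite acos_gt0.
move=> p q vp dq; pose u := hcoord q; have u0 : u != 0 by exact: hcoord_neq0.
have u1 := vnorm2_gt0 u0.
have uq : coords u q := coords_hcoord q.
have cu : 1 - k / 2 < line_cosR v u.
  rewrite (coords_mdist vp uq) in dq.
  move/andP: cI => [c1 /ltW c2].
  rewrite -(@acosK _ (line_cosR v u)) ?in_itv/= ?line_cosR_itv//.
  rewrite -[X in X < _](@acosK _ (1 - k / 2)) ?in_itv/= ?c1//.
  by rewrite ltr_cos// in_itv/= acos_ge0 ?acos_lepi ?line_cosR_itv ?c1.
have c1 : 0 < line_cosR v u by lra.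
have cle := line_cosR_le1 v0 u0.
have [a a0 aE] := line_cosR_proj u0 v0 c1.
exists (a *: u); first exact: coordsZ uq.
rewrite aE; apply: lt_le_trans kd; rewrite mulrC ltr_pM2r//.
nra.
Qed.

End HomogeneousCoordinates.

(** * A closed form for the iterates of F *)

Section Orbits.
Variable R : realType.
Local Notation C := R[i].
Implicit Types (u v w z : 'rV[C]_3) (p q : P2 R) (m M : C).

Lemma F_polyE v : F_poly v =
  vec3 (v 0 0 * (v 0 0 ^+ 2 - v 0 1 ^+ 2 - v 0 2 ^+ 2)) (v 0 1 ^+ 2 * v 0 2)
      (v 0 2 * (v 0 0 ^+ 2 - v 0 2 ^+ 2)).
Proof. by []. Qed.

(** Writing Q for the left side of the second equation, the two equations say
    that m is an inverse image of Q / (2 z1 z2) under the Joukowski map (m +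
    1/m) / 2. The factor k replaces divisions, so that m = 0 stands for the
    value infinity. *)
Definition joukowski z m (k : C) : Prop :=
  z 0 1 * z 0 2 = k * m /\
  z 0 0 ^+ 2 - z 0 1 ^+ 2 - z 0 2 ^+ 2 = k * (1 + m ^+ 2).

(** Put S(x) = x - 1/x. If z = (S(l), S(u), S(l/u)) and m = 1/l, then F sends
    [S(l) : S(u) : S(l/u)] to [S(l^2) : S(u) : S(l^2/u)], as follows from the
    addition formulas of the sine; for M = m^(N-1) the vector below is a
    multiple of (S(l^N), S(u), S(l^N/u)). In this polynomial form it makes
    sense for all z and m, including m = 0. *)
Definition orbit_vec M z m : 'rV[C]_3 :=
  vec3 (z 0 0 * (1 - m ^+ 2 * M ^+ 2)) (z 0 1 * (1 - m ^+ 2) * M)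
      (z 0 2 + m * z 0 1 - m * M ^+ 2 * (m * z 0 2 + z 0 1)).

(** One application of F replaces m^(N-1) by m^(2N-1) = m * (m^(N-1))^2, that
    is, doubles N. *)
Lemma F_orbit_vec M z m (k : C) : joukowski z m k ->
  F_poly (orbit_vec M z m) =
  ((1 - m ^+ 2) * (k + z 0 1 ^+ 2 - M ^+ 2 * (m ^+ 2 * k + z 0 1 ^+ 2))) *:
    orbit_vec (m * M ^+ 2) z m.
Proof.
rewrite F_polyE /orbit_vec /joukowski !vec3_0 !vec3_1 !vec3_2.
move: (z 0 0) (z 0 1) (z 0 2) => a b c [/eqP h1 /eqP h2].
set s := m ^+ 2 * M ^+ 2; set P2 := c + _ - _.
set cn := (1 - m ^+ 2) * _.
move: h1; rewrite -subr_eq0 => /eqP; set e1 := _ - _ => h1.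
move: h2; rewrite -subr_eq0 => /eqP; set e2 := _ - _ => h2.
(* e1 and e2 are the defects of the two relations between z, m and k; each
   coordinate is a polynomial identity up to multiples of e1 and e2, and D is
   the value of the difference of squares in the first and third coordinates *)
pose D := (1 - m ^+ 2) * (k * (1 - s ^+ 2) + b ^+ 2 * (1 - m ^+ 2 * M ^+ 4)).
have DE : (a * (1 - s)) ^+ 2 - P2 ^+ 2 = D.
  have -> : (a * (1 - s)) ^+ 2 - P2 ^+ 2 =
      D + (1 - s) ^+ 2 * e2 - 2 * m * (1 - s) * (1 - M ^+ 2) * e1.
    by rewrite /P2 /D /e1 /e2 /s; ring.
  by rewrite h1 h2 !mulr0 subr0 addr0.
apply/rowP => i; rewrite !mxE; case: i => -[|[|[|//]]] ? /=.
- rewrite [_ - _ - P2 ^+ 2]addrAC DE.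
  by rewrite /D /cn /s; ring.
- have -> : (b * (1 - m ^+ 2) * M) ^+ 2 * P2 =
      b * (1 - m ^+ 2) * M * (m * M * cn + M * (1 - m ^+ 2) * (1 - s) * e1).
    by rewrite /P2 /cn /e1 /s; ring.
  by rewrite h1; ring.
- rewrite DE; apply/eqP; rewrite -subr_eq0; apply/eqP.
  transitivity ((1 - m ^+ 2) * b * e1 *
      ((1 - s) * (1 - m ^+ 2 * M ^+ 4) - (1 - M ^+ 2) * (1 - s ^+ 2))).
    by rewrite /P2 /D /cn /e1 /s; ring.
  by rewrite h1 mulr0 mul0r.
Qed.

Lemma orbit_vec1 z m : orbit_vec 1 z m = (1 - m ^+ 2) *: z.
Proof.
by rewrite (vec3E z) /orbit_vec !vec3_0 !vec3_1 !vec3_2; apply/rowP => i; rewrite !mxE;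
  case: i => -[|[|[|//]]] ? /=; ring.
Qed.

(** The first indeterminate point on the orbit of p puts p into I_n for some
    n. *)
Lemma ext_indet_iter p n : ~ ext_indet R p -> ~ indet R (iter n (@F R) p).
Proof.
move=> nE In; apply: nE; apply: subset_closure.
pose P k := `[< indet R (iter k (@F R) p) >].
have exP : exists k, P k by exists n; apply/asboolP.
have [k /asboolP Pk kmin] := ex_minnP exP.
exists k.+1 => //=; exists k.+1; split => //=.
move=> j jk /asboolP Ij; have := kmin j Ij; rewrite leqNgt.
by rewrite -ltnS jk.
Qed.

(** Off E the vector [F_poly] of an iterate never vanishes, so the scalar
    factor in [F_orbit_vec] is automatically nonzero and the closed form
    propagates. At n = 0 the vector is (1 - m^2) z, so m^2 != 1 is needed. *)
Lemma coords_iter z p m (k : C) n : coords z p -> ~ ext_indet R p -> m ^+ 2 != 1 ->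
  joukowski z m k -> coords (orbit_vec (m ^+ (2 ^ n).-1) z m) (iter n (@F R) p).
Proof.
move=> zp pE m1 jz; elim: n => [|n IH].
  by rewrite expr0 orbit_vec1; apply: coordsZ zp; rewrite subr_eq0 eq_sym.
have nI := ext_indet_iter (n := n) pE.
have := coords_F IH nI; rewrite (F_orbit_vec _ jz).
set c := _ * (_ - _) => H.
have c0 : c != 0.
  by apply: contraNneq (coords_neq0 H) => ->; rewrite scale0r.
have -> : m ^+ (2 ^ n.+1).-1 = m * (m ^+ (2 ^ n).-1) ^+ 2.
  rewrite -exprM -exprS; congr (_ ^+ _).
  have : (0 < 2 ^ n)%N by rewrite expn_gt0.
  by rewrite expnS mulnC; case: (2 ^ n)%N => // K _; rewrite mulSn.
have := coordsZ _ H; move=> /(_ c^-1).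
by rewrite invr_eq0 scalerA mulVf// scale1r; exact.
Qed.

Lemma nbhs_mdist p (U : set (P2 R)) : nbhs p U ->
  exists2 e, 0 < e & forall q, mdist p q < e -> U q.
Proof.
by move=> /nbhs_ballP[e e0 H]; exists e => // q pq; apply: H; rewrite ballEmdist.
Qed.

Lemma mdist_nbhs p e : 0 < e -> nbhs p [set q | mdist p q < e].
Proof.
by move=> e0; apply/nbhs_ballP; exists e => //= q; rewrite ballEmdist.
Qed.

Lemma ext_indet_near v p : coords v p -> ~ ext_indet R p ->
  exists2 d, 0 < d & forall w q, vnorm2 (w - v) < d -> coords w q -> ~ ext_indet R q.
Proof.
move=> vp pE; have : nbhs p (~` ext_indet R).
  by apply: open_nbhs_nbhs; split=> //; apply: closed_openC; exact: closed_closure.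
move=> /nbhs_mdist[e e0 He]; have [k k0 Hk] := mdist_lt e0.
exists (k * vnorm2 v); first by rewrite mulr_gt0// vnorm2_gt0// (coords_neq0 vp).
by move=> w q wv wq; apply: He; exact: Hk vp wq wv.
Qed.

End Orbits.

(** * Spectral conics and uniform estimates *)

Section Spectrum.
Variable R : realType.
Local Notation C := R[i].
Implicit Types (u v w z : 'rV[C]_3) (p q : P2 R) (m k M : C).

Definition on_spectral_conic z := exists2 x : R, -1 <= x <= 1 &
  z 0 0 ^+ 2 - z 0 1 ^+ 2 - z 0 2 ^+ 2 = 2 * (z 0 1 * z 0 2) * (x%:C)%C.

Lemma Re_unit m : normc m = 1 -> 1 + m ^+ 2 = m * (2 * (complex.Re m)%:C%C).
Proof.
move=> m1; rewrite -addcJ mulrDr [m * m^*%C]mulrC -[m * m]expr2 addrC.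
suff -> : m^*%C * m = 1 by [].
by rewrite mulrC -[m * _]normCK -normcE m1 (rmorph1 (real_complex R)) expr1n.
Qed.

Lemma normc_Re_le m : normc m = 1 -> -1 <= complex.Re m <= 1.
Proof.
move=> m1; have := normc_sqE m; rewrite m1 expr1n => E.
have := sqr_ge0 (complex.Im m).
by move=> H; apply/andP; split; nra.
Qed.

(** On the unit circle the Joukowski map takes the real value [Re m]. *)
Lemma joukowski_unit z m k : joukowski z m k -> normc m = 1 -> on_spectral_conic z.
Proof.
move=> [h1 h2] m1; exists (complex.Re m); first exact: normc_Re_le.
by rewrite h2 h1 Re_unit//; ring.
Qed.

(** With a = Q and b = z1 z2 the parameter m is a root of b m^2 - a m + b; the
    two roots are inverse to each other, so one of them lies in the closed
    unit disk. *)
Lemma joukowski_exists z : exists m k, joukowski z m k /\ normc m <= 1.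
Proof.
rewrite /joukowski; move: (z 0 0 ^+ 2 - _ - _) (z 0 1 * z 0 2) => a b.
have [->|b0] := eqVneq b 0.
  exists 0, a; rewrite normc0 ler01 expr0n addr0 mulr0 mulr1; split => //.
pose t := a / b; pose s := sqrtC (t ^+ 2 - 4).
have s2 : s ^+ 2 = t ^+ 2 - 4 by rewrite sqrtCK.
suff [m [m0 mE m1]] : exists m, [/\ m != 0, 1 + m ^+ 2 = t * m & normc m <= 1].
  exists m, (b / m); split => //; split; first by rewrite divfK.
  by rewrite mE /t; field; rewrite b0 m0.
have sol e : e ^+ 2 = s ^+ 2 -> 1 + ((t + e) / 2) ^+ 2 = t * ((t + e) / 2).
  move=> e2; apply/eqP; rewrite -subr_eq0; apply/eqP.
  transitivity ((e ^+ 2 - (t ^+ 2 - 4)) / 4); first by field.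
  by rewrite e2 s2 subrr mul0r.
have pr : (t + s) / 2 * ((t - s) / 2) = 1.
  transitivity ((t ^+ 2 - s ^+ 2) / 4); first by field.
  by rewrite s2; field.
have : normc ((t + s) / 2) * normc ((t - s) / 2) = 1.
  by rewrite -normcM pr; exact: normc1.
have : (t + s) / 2 * ((t - s) / 2) != 0 by rewrite pr oner_neq0.
rewrite mulf_eq0 negb_or => /andP[p0 q0] E.
have [le1|lt1] := leP (normc ((t + s) / 2)) 1.
  by exists ((t + s) / 2); split=> //; apply: sol.
exists ((t - s) / 2); split=> //; first by apply: sol; rewrite sqrrN.
have := normc_ge0 ((t - s) / 2); nra.
Qed.

Lemma joukowski_lt1 z : ~ on_spectral_conic z ->
  exists m k, [/\ joukowski z m k, normc m < 1 & k != 0].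
Proof.
move=> nS; have [m [k [jz m1]]] := joukowski_exists z; exists m, k; split => //.
  rewrite lt_neqAle m1 andbT; apply/eqP => mE; apply: nS.
  exact: joukowski_unit jz mE.
apply/eqP => k0; apply: nS; exists 0; first by rewrite lerN10 ler01.
by case: jz => _ ->; rewrite k0 mul0r (rmorph0 (real_complex R)) mulr0.
Qed.

Lemma normc_lt1_sq m : normc m < 1 -> m ^+ 2 != 1.
Proof.
move=> m1; apply/eqP => E; have := normcX m 2; rewrite E.
rewrite normc_one.
have := normc_ge0 m => ? ?; nra.
Qed.

(** Let (a0, b0) and (a, b) be the values of (Q, z1 z2) at v and at w. As b
    (m^2 + 1) = a m, the number b0 (m^2 + 1) - a0 m is as small as the
    differences a0 - a and b0 - b; it factors as k0 (m0 m - 1) (m - m0), where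
    |m0 m - 1| >= 1 - |m0|. *)
Lemma joukowski_stable v w m0 k0 m k : joukowski v m0 k0 -> joukowski w m k ->
  normc m0 < 1 -> normc m <= 1 ->
  normc k0 * (1 - normc m0) * normc (m - m0) <=
  2 * normc (v 0 1 * v 0 2 - w 0 1 * w 0 2) +
  normc (v 0 0 ^+ 2 - v 0 1 ^+ 2 - v 0 2 ^+ 2 -
        (w 0 0 ^+ 2 - w 0 1 ^+ 2 - w 0 2 ^+ 2)).
Proof.
rewrite /joukowski; move: (v 0 0 ^+ 2 - _ - _) (v 0 1 * v 0 2) => a0 b0.
move: (w 0 0 ^+ 2 - _ - _) (w 0 1 * w 0 2) => a b [h1 h2] [h3 h4] m01 m1.
have E : k0 * (m0 * m - 1) * (m - m0) =
    (b0 - b) * (m ^+ 2 + 1) - (a0 - a) * m.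
  by rewrite h1 h2 h3 h4; ring.
have n0 := normc_ge0 m0; have n1 := normc_ge0 m.
have le1 : 1 - normc m0 <= normc (m0 * m - 1).
  have : normc (1 : C) <= normc (m0 * m) + normc (1 - m0 * m).
    by rewrite -[X in normc X <= _](subrK (m0 * m)) addrC; exact: le_normcD.
  rewrite normc_distC; rewrite normc_one.
  by rewrite normcM; nra.
have m2 : normc (m ^+ 2 + 1) <= 2.
  apply: le_trans (le_normcD _ _) _.
  rewrite normc_one.
  by rewrite normcX; nra.
apply: (@le_trans _ _ (normc (k0 * (m0 * m - 1) * (m - m0)))).
  rewrite !normcM ler_wpM2r ?normc_ge0// ler_wpM2l ?normc_ge0//.
rewrite E; apply: le_trans (le_normcB _ _) _; rewrite !normcM.
have := normc_ge0 (b0 - b); have := normc_ge0 (a0 - a) => A B.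
by apply: lerD; nra.
Qed.

(** The bound does not depend on the exponent because the geometric series of
    |m0| converges; it makes all later estimates uniform in the number of
    iterations. *)
Lemma normc_expB m m0 K : normc m0 < 1 -> normc m <= 1 ->
  normc (m ^+ K - m0 ^+ K) <= normc (m - m0) / (1 - normc m0).
Proof.
move=> m01 m1; have m0_ge := normc_ge0 m0; have m_ge := normc_ge0 m.
have d0 : 0 < 1 - normc m0 by rewrite subr_gt0.
rewrite ler_pdivlMr//.
elim: K => [|K IH]; first by rewrite !expr0 subrr normc0 mul0r normc_ge0.
have -> : m ^+ K.+1 - m0 ^+ K.+1 = m ^+ K * (m - m0) + m0 * (m ^+ K - m0 ^+ K).
  by rewrite !exprS; ring.
have H1 : normc (m ^+ K) <= 1 by rewrite normcX exprn_ile1.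
have := le_normcD (m ^+ K * (m - m0)) (m0 * (m ^+ K - m0 ^+ K)).
rewrite !normcM.
set y := normc (_ + _); move: (normc_ge0 (m - m0)) IH H1.
move: (normc (m - m0)) (normc (m ^+ K)) (normc (m ^+ K - m0 ^+ K)) y d0 m0_ge.
move: (normc m0) => r d a x y d0 r0 dd IH a1 H.
have h1 : a * d <= d by rewrite ler_piMl.
have h2 : r * (x * (1 - r)) <= r * d by rewrite ler_wpM2l.
have h3 : y * (1 - r) <= (a * d + r * x) * (1 - r) by rewrite ler_wpM2r// ltW.
have h4 : a * d * (1 - r) <= d * (1 - r) by rewrite ler_wpM2r// ltW.
lra.
Qed.

(** If z0 is nonzero, the first coordinate of [orbit_vec M v m] has modulus at
    least |z0| (1 - |m|). If z0 = 0, the relations give (z2 + m z1) (m z2 +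
    z1) = 0, so that m z2 + z1 = 0 and the third coordinate is z2 + m z1
    whatever M is. *)
Lemma orbit_vec_lower v m k : joukowski v m k -> normc m < 1 ->
  ~ (v 0 0 = 0 /\ v 0 2 + m * v 0 1 = 0) ->
  exists2 c, 0 < c & forall M, normc M <= 1 -> c <= vnorm2 (orbit_vec M v m).
Proof.
move=> [h1 h2] m1 nG; have m0 := normc_ge0 m.
have [v0|v0] := eqVneq (v 0 0) 0.
  have G0 : v 0 2 + m * v 0 1 != 0 by apply/eqP => E; apply: nG.
  exists (normc (v 0 2 + m * v 0 1) ^+ 2); first by rewrite exprn_gt0// normc_gt0.
  have : (v 0 2 + m * v 0 1) * (m * v 0 2 + v 0 1) = 0.
    transitivity ((1 + m ^+ 2) * (v 0 1 * v 0 2) -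
        m * (v 0 0 ^+ 2 - v 0 1 ^+ 2 - v 0 2 ^+ 2)).
      by rewrite v0; ring.
    by rewrite h1 h2; ring.
  move/eqP; rewrite mulf_eq0 (negPf G0)/= => /eqP E M _.
  rewrite /vnorm2 /orbit_vec !vec3_0 !vec3_1 !vec3_2 E mulr0 subr0 lerDr.
  by rewrite addr_ge0 ?sqr_ge0.
exists (normc (v 0 0) ^+ 2 * (1 - normc m) ^+ 2).
  by rewrite mulr_gt0// exprn_gt0 ?normc_gt0// subr_gt0.
move=> M M1; rewrite /vnorm2 /orbit_vec !vec3_0 !vec3_1 !vec3_2 -addrA.
apply: (@le_trans _ _ (normc (v 0 0 * (1 - m ^+ 2 * M ^+ 2)) ^+ 2)); last first.
  by rewrite lerDl addr_ge0 ?sqr_ge0.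
rewrite normcM exprMn ler_wpM2l ?sqr_ge0// lerXn2r ?nnegrE ?normc_ge0//.
  by rewrite subr_ge0 ltW.
have : normc (1 : C) <= normc (m ^+ 2 * M ^+ 2) + normc (1 - m ^+ 2 * M ^+ 2).
  by rewrite -[X in normc X <= _](subrK (m ^+ 2 * M ^+ 2)) addrC; exact: le_normcD.
rewrite normc_one.
rewrite normcM !normcX; have M0 := normc_ge0 M.
have : normc m ^+ 2 * normc M ^+ 2 <= normc m.
  have : normc M ^+ 2 <= 1 by rewrite exprn_ile1.
  have := sqr_ge0 (normc M); move: (normc M ^+ 2) => y; nra.
lra.
Qed.

(** Two points of the ball of radius B at distance at most c d. The rules
    [lipD], [lipN] and [lipM] let unification compute B and c for polynomial
    expressions. *)
Definition lip (d B c : R) (x y : C) :=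
  [/\ normc x <= B, normc y <= B & normc (x - y) <= c * d].

Lemma lipD d B c x y B' c' x' y' : lip d B c x y -> lip d B' c' x' y' ->
  lip d (B + B') (c + c') (x + x') (y + y').
Proof.
move=> [h1 h2 h3] [h4 h5 h6]; split.
- exact: le_trans (le_normcD _ _) (lerD h1 h4).
- exact: le_trans (le_normcD _ _) (lerD h2 h5).
- rewrite mulrDl opprD addrACA.
  exact: le_trans (le_normcD _ _) (lerD h3 h6).
Qed.

Lemma lipN d B c x y : lip d B c x y -> lip d B c (- x) (- y).
Proof. by move=> [h1 h2 h3]; split; rewrite ?normcN// -opprD normcN. Qed.

Lemma lipM d B c x y B' c' x' y' : lip d B c x y -> lip d B' c' x' y' ->
  lip d (B * B') (B * c' + c * B') (x * x') (y * y').
Proof.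
move=> [h1 h2 h3] [h4 h5 h6]; split.
- by rewrite normcM ler_pM ?normc_ge0.
- by rewrite normcM ler_pM ?normc_ge0.
- have -> : x * x' - y * y' = x * (x' - y') + (x - y) * y' by ring.
  apply: le_trans (le_normcD _ _) _; rewrite !normcM mulrDl.
  rewrite -mulrA [c * B' * d]mulrAC.
  by apply: lerD; apply: ler_pM; rewrite ?normc_ge0.
Qed.

Lemma lip1 d : 0 <= d -> lip d 1 0 1 1.
Proof.
move=> d0; have e : normc (1 : C) = 1 by exact: normc1.
by split; rewrite ?e// subrr mul0r normc0.
Qed.

Lemma orbit_vec_lip (A : R) : exists2 c, 0 < c & forall v w m0 m M0 M d, 0 <= d ->
  (forall i, lip d A 1 (w 0 i) (v 0 i)) -> lip d 1 1 m m0 -> lip d 1 1 M M0 ->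
  vnorm2 (orbit_vec M w m - orbit_vec M0 v m0) <= c * d ^+ 2.
Proof.
have [B0 [c0 H0]] : exists B c, forall v w m0 m M0 M d, 0 <= d ->
  (forall i, lip d A 1 (w 0 i) (v 0 i)) -> lip d 1 1 m m0 -> lip d 1 1 M M0 ->
  lip d B c (orbit_vec M w m 0 0) (orbit_vec M0 v m0 0 0).
  eexists; eexists => v w m0 m M0 M d d0 hv hm hM; rewrite /orbit_vec !vec3_0 !expr2.
  by do ![exact: hv|exact: hm|exact: hM|exact: (lip1 d0)|apply: lipM
         |apply: lipD|apply: lipN].
have [B1 [c1 H1]] : exists B c, forall v w m0 m M0 M d, 0 <= d ->
  (forall i, lip d A 1 (w 0 i) (v 0 i)) -> lip d 1 1 m m0 -> lip d 1 1 M M0 ->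
  lip d B c (orbit_vec M w m 0 1) (orbit_vec M0 v m0 0 1).
  eexists; eexists => v w m0 m M0 M d d0 hv hm hM; rewrite /orbit_vec !vec3_1 !expr2.
  by do ![exact: hv|exact: hm|exact: hM|exact: (lip1 d0)|apply: lipM
         |apply: lipD|apply: lipN].
have [B2 [c2 H2]] : exists B c, forall v w m0 m M0 M d, 0 <= d ->
  (forall i, lip d A 1 (w 0 i) (v 0 i)) -> lip d 1 1 m m0 -> lip d 1 1 M M0 ->
  lip d B c (orbit_vec M w m 0 2) (orbit_vec M0 v m0 0 2).
  eexists; eexists => v w m0 m M0 M d d0 hv hm hM; rewrite /orbit_vec !vec3_2 !expr2.
  by do ![exact: hv|exact: hm|exact: hM|exact: (lip1 d0)|apply: lipM
         |apply: lipD|apply: lipN].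
exists (c0 ^+ 2 + c1 ^+ 2 + c2 ^+ 2 + 1).
  by rewrite ltr_wpDl// !addr_ge0 ?sqr_ge0.
move=> v w m0 m M0 M d d0 hv hm hM.
have [_ _ h0] := H0 _ _ _ _ _ _ _ d0 hv hm hM.
have [_ _ h1] := H1 _ _ _ _ _ _ _ d0 hv hm hM.
have [_ _ h2] := H2 _ _ _ _ _ _ _ d0 hv hm hM.
have sq x c : normc x <= c * d -> normc x ^+ 2 <= c ^+ 2 * d ^+ 2.
  move=> h; rewrite -exprMn lerXn2r ?nnegrE ?normc_ge0//.
  exact: le_trans (normc_ge0 _) h.
rewrite !mulrDl mul1r; apply: ler_wpDr; first exact: sqr_ge0.
rewrite /vnorm2; do 2?apply: lerD; apply: sq.
- by move: h0; rewrite !mxE.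
- by move: h1; rewrite !mxE.
- by move: h2; rewrite !mxE.
Qed.

End Spectrum.

(** * Dyadic roots of unity *)

Section RootsOfUnity.
Variable R : realType.
Local Notation C := R[i].

Definition expi (t : R) : C := (cos t +i* sin t)%C.

Lemma expiD s t : expi (s + t) = expi s * expi t.
Proof.
by rewrite /expi cosD sinD; apply/eqP; rewrite eq_complex /= eqxx/= addrC.
Qed.

Lemma expiX t n : expi t ^+ n = expi (t *+ n).
Proof.
elim: n => [|n IH]; first by rewrite expr0 mulr0n /expi cos0 sin0.
by rewrite exprS IH mulrS expiD.
Qed.

(** The angles pi k / 2^J with 0 < k < 2^J, for all J, are dense in the
    interval from 0 to pi and avoid its end points, where w is 1 or -1. *)
Lemma dyadic_root_dense (x e : R) : -1 <= x <= 1 -> 0 < e ->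
  exists j w, [/\ w ^+ (2 ^ j) = 1 :> C, w ^+ 2 != 1 &
                  `|complex.Re w - x| < e].
Proof.
move=> x1 e0; pose t := acos x.
have t0 : 0 <= t by exact: acos_ge0.
have tpi : t <= pi by exact: acos_lepi.
have xE : x = cos t by rewrite acosK// in_itv.
have [d d0 Hd] : exists2 d, 0 < d & forall s, `|t - s| < d -> `|cos s - x| < e.
  have := @continuous_cos R t => /cvgrPdist_lt /(_ _ e0) /nbhs_ballP[d /= d0 H].
  by exists d => // s /H; rewrite xE distrC.
have pi0 := pi_gt0 R.
have [J [L [LE L2 Ld]]] : exists J (L : R),
    [/\ (2 ^ J.+1)%:R = 2 * L, 2 <= L & pi / L < d].
  pose J := (Num.bound (pi / d)).+1; exists J, (2 ^+ J).
  have H : pi / d < 2 ^+ J by exact: upper_nthrootP.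
  rewrite natrX exprS; split=> //; first by rewrite exprS ler_peMr// exprn_ege1// ler1n.
  by rewrite ltr_pdivrMr ?exprn_gt0// mulrC -ltr_pdivrMr.
have L0 : 0 < L by rewrite (lt_le_trans _ L2).
pose y := t * L / pi.
have y0 : 0 <= y by rewrite /y; apply: divr_ge0; [apply: mulr_ge0|] => //; exact: ltW.
have yL : y <= L by rewrite ler_pdivrMr// mulrC ler_wpM2l// ltW.
have [k [k0 kL ky]] : exists k : nat,
    [/\ 0 < (k%:R : R), (k%:R : R) < L & `|k%:R - y| <= 1].
  have /andP[y1 y2] := truncn_itv y0.
  set K := Num.truncn y in y1 y2.
  have [K0|K0] := posnP K.
    exists 1%N; split; [exact: ltr01|by rewrite (lt_le_trans _ L2)// ltr1n|].
    by rewrite K0 in y2; rewrite ler_norml; apply/andP; split; lra.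
  have [KL|KL] := ltP (K%:R) L.
    exists K; split=> //; first by rewrite ltr0n.
    by rewrite -natr1 in y2; rewrite ler_norml; apply/andP; split; lra.
  have E1 : K%:R = L by apply/eqP; rewrite eq_le KL (le_trans y1).
  have E2 : K%:R = y by apply/eqP; rewrite eq_le y1 (le_trans yL).
  have E3 : K.-1%:R + 1 = K%:R :> R by rewrite natr1 prednK.
  exists K.-1; rewrite ler_norml.
  by split; [lra|lra|apply/andP; split; lra].
pose s := pi * k%:R / L.
exists J.+1, (expi s); split.
- rewrite expiX; move: (2 ^ J.+1)%N LE => N LE.
  have -> : s *+ N = 0 + pi *+ 2 *+ k.
    rewrite add0r -[LHS]mulr_natr LE -[RHS]mulr_natr -[pi *+ 2]mulr_natr /s.
    by field; rewrite gt_eqF.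
  have c1 := periodicn (@cosD2pi R) k 0; rewrite cos0 in c1.
  have s1 := periodicn (@sinD2pi R) k 0; rewrite sin0 in s1.
  by rewrite /expi; apply/eqP; rewrite eq_complex /= c1 s1 !eqxx.
- have s0 : 0 < sin s.
    by apply: sin_gt0_pi; rewrite divr_gt0 ?mulr_gt0//= ltr_pdivrMr// ltr_pM2l.
  apply/eqP => /eqP; rewrite sqrf_eq1 => /orP[] /eqP[_ /eqP]; rewrite ?oppr0 gt_eqF//.
- rewrite /=; apply: Hd; apply: le_lt_trans Ld.
  have E (P M a b : R) : P != 0 -> M != 0 ->
      a - P * b / M = (a * M / P - b) * (P / M).
    by move=> P0 M0; field; rewrite P0 M0.
  rewrite /s E ?gt_eqF// -/y.
  rewrite normrM distrC [`|pi / L|]gtr0_norm ?divr_gt0//.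
  by rewrite ler_piMl// ltW// divr_gt0.
Qed.

Lemma normc_root (w : C) n : (0 < n)%N -> w ^+ n = 1 -> normc w = 1.
Proof.
move=> n0 wn; have := normcX w n; rewrite wn.
rewrite normc_one.
move=> /esym/eqP; by rewrite pexpr_eq1 ?normc_ge0// => /eqP.
Qed.

Lemma pow_small (r e : R) : 0 <= r < 1 -> 0 < e ->
  exists n0, forall n, (n0 <= n)%N -> r ^+ (2 ^ n).-1 < e.
Proof.
move=> /andP[r0 r1] e0.
have /cvg_expr : `|r| < 1 by rewrite ger0_norm.
move=> /cvgrPdist_lt /(_ _ e0) [N _ HN]; exists N => n Nn.
have := HN (2 ^ n).-1; rewrite /= sub0r normrN ger0_norm ?exprn_ge0//; apply.
by apply: leq_trans Nn _; rewrite -ltnS prednK ?expn_gt0// ltn_expl.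
Qed.

End RootsOfUnity.

(** * Equicontinuity off the spectrum *)

Section FatouJulia.
Variable R : realType.
Local Notation C := R[i].
Implicit Types (u v w z : 'rV[C]_3) (p q : P2 R) (m k M : C).

(** Up to scaling, v = (0, 1, -m). It is the limit, when M = m^(2^n - 1) tends
    to 0, of the vectors (M (1 - m^2), 1 - m^2 M^2, -m (1 - M^2)), which have
    the same parameter m and whose [orbit_vec M] is a multiple of (1, 1, 0), a
    common zero of the coordinates of F. *)
Lemma degenerate_ext_indet v p m : coords v p -> normc m < 1 ->
  v 0 0 = 0 -> v 0 2 + m * v 0 1 = 0 -> ext_indet R p.
Proof.
move=> vp m1 v0 v2; apply: contrapT => pE.
have m0 := normc_ge0 m.
have v10 : v 0 1 != 0.
  apply: contraNneq (coords_neq0 vp) => v10; rewrite v10 mulr0 addr0 in v2.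
  by rewrite (vec3E v) v0 v10 v2; apply/eqP/rowP => i; rewrite !mxE;
    case: i => -[|[|[|//]]].
pose v' := vec3 0 1 (- m).
have vp' : coords v' p.
  have -> : v' = (v 0 1)^-1 *: v.
    have -> : v = vec3 0 (v 0 1) (- m * v 0 1).
      by rewrite [LHS]vec3E v0; congr vec3; apply/eqP; rewrite -subr_eq0 mulNr opprK v2.
    rewrite vec3_1; apply/rowP => i; rewrite !mxE.
    by case: i => -[|[|[|//]]] ? /=; field.
  by apply: coordsZ vp; rewrite invr_eq0.
have [d d0 Hd] := ext_indet_near vp' pE.
have d6 : 0 < Num.min 1 (d / 6) by rewrite lt_min ltr01 divr_gt0.
have [n0 Hn] := pow_small (r := normc m) (andb_true_intro (conj m0 m1)) d6.
have := Hn n0 (leqnn _); rewrite lt_min -normcX; set M := m ^+ _ => /andP[M1 Md].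
have M0 := normc_ge0 M.
have m2 : normc (m ^+ 2) <= 1 by rewrite normcX exprn_ile1// ltW.
have mM : normc (m ^+ 2 * M ^+ 2) < 1.
  by rewrite normcM [normc (M ^+ 2)]normcX; have := normc_ge0 (m ^+ 2); nra.
pose z := vec3 (M * (1 - m ^+ 2)) (1 - m ^+ 2 * M ^+ 2) (- m * (1 - M ^+ 2)).
have jz : joukowski z m (- (1 - m ^+ 2 * M ^+ 2) * (1 - M ^+ 2)).
  by rewrite /joukowski /z vec3_0 vec3_1 vec3_2; split; ring.
have z0 : z != 0.
  apply/eqP => /rowP /(_ 1); rewrite vec3_1 mxE => /eqP; rewrite subr_eq0 => /eqP E.
  move: mM; rewrite -E.
  rewrite normc_one.
  by rewrite ltxx.
have [q zq] := coords_exists z0.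
have qE : ~ ext_indet R q.
  apply: Hd zq; rewrite /vnorm2 !mxE /=.
  have -> : M * (1 - m ^+ 2) - 0 = M * (1 - m ^+ 2) by rewrite subr0.
  have -> : 1 - m ^+ 2 * M ^+ 2 - 1 = - (m ^+ 2 * M ^+ 2) by ring.
  have -> : - m * (1 - M ^+ 2) - (- m) = m * M ^+ 2 by ring.
  rewrite normcN (normcM M) (normcM (m ^+ 2)) (normcM m (M ^+ 2)).
  rewrite [normc (M ^+ 2)]normcX.
  have h1 : normc (1 - m ^+ 2) <= 2.
    apply: le_trans (le_normcB _ _) _.
    rewrite normc_one.
    lra.
  have h0 := normc_ge0 (1 - m ^+ 2); have h2 := normc_ge0 (m ^+ 2).
  have N2 : normc M ^+ 2 <= normc M by nra.
  have N20 : 0 <= normc M ^+ 2 by exact: sqr_ge0.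
  have sq (x y : R) : 0 <= x -> x <= y -> x ^+ 2 <= y ^+ 2.
    by move=> x0 xy; rewrite lerXn2r ?nnegrE// (le_trans x0).
  move: (normc (1 - _)) (normc (m ^+ 2)) h0 h1 h2 m2 => a b a0 a2 b0 b1.
  move: (normc m) (normc M) m0 m1 M0 M1 Md N2 N20 => r N r0 r1 N0 N1 Nd N2 N20.
  have h1 : (N * a) ^+ 2 <= (2 * N) ^+ 2.
    by apply: sq; rewrite ?mulr_ge0// mulrC ler_wpM2r.
  have h2 : (b * N ^+ 2) ^+ 2 <= N ^+ 2.
    apply: sq; rewrite ?mulr_ge0//; apply: le_trans N2.
    by rewrite ler_piMl.
  have h3 : (r * N ^+ 2) ^+ 2 <= N ^+ 2.
    apply: sq; rewrite ?mulr_ge0//; apply: le_trans N2.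
    by rewrite ler_piMl// ltW.
  rewrite exprMn in h1; lra.
have nz := coords_iter n0 zq qE (normc_lt1_sq m1) jz.
apply: (ext_indet_iter (n := n0) qE); apply/(coords_indet nz).
rewrite -/M F_polyE /orbit_vec /z !vec3_0 !vec3_1 !vec3_2.
by apply/rowP => i; rewrite !mxE; case: i => -[|[|[|//]]] ? /=; ring.
Qed.

Lemma diam_lt (M : metricType R) (X : set M) a e : 0 < e ->
  (forall x, X x -> mdist a x < e / 3) -> (diam X < e%:E)%E.
Proof.
move=> e0 H; apply: (@le_lt_trans _ _ (e / 3 + e / 3)%:E); last by rewrite lte_fin; lra.
apply: ge_ereal_sup => _ [[x y] [/= /H ax /H ay] <-].
by rewrite lee_fin (le_trans (metric_triangle _ a _))// lerD ?ltW// metric_sym.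
Qed.

Lemma mdist_diam (M : metricType R) (X : set M) x y e : (diam X < e%:E)%E ->
  X x -> X y -> mdist x y < e.
Proof.
move=> H Xx Xy; rewrite -lte_fin; apply: le_lt_trans H.
by apply: ereal_sup_ubound; exists (x, y).
Qed.

(** The vector of the n-th iterate is a Lipschitz function of (z, m) and is
    bounded away from 0, both uniformly in n, and m is a Lipschitz function of
    z; the iterates of F are therefore equicontinuous at p. The lower bound is
    [orbit_vec_lower], whose exceptional case is excluded by
    [degenerate_ext_indet]. *)
Lemma fatou_off_spectrum v p : coords v p ->
  ~ on_spectral_conic v -> ~ ext_indet R p -> fatou_point p.
Proof.
move=> vp nS pE; split => // e e0.
have [m0 [k0 [jv m01 k00]]] := joukowski_lt1 nS.
have [c c0 Hc] : exists2 c, 0 < c &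
    forall M, normc M <= 1 -> c <= vnorm2 (orbit_vec M v m0).
  by apply: (orbit_vec_lower jv m01) => -[/(degenerate_ext_indet vp m01) H /H].
have e3 : 0 < e / 3 by rewrite divr_gt0.
have [kap kap0 Hkap] := mdist_lt e3.
pose A := vnorm2 v + 2.
have A0 : 0 <= A by rewrite addr_ge0 ?vnorm2_ge0.
have vA i : normc (v 0 i) <= vnorm2 v + 1.
  have H x : x <= x ^+ 2 + 1 :> R by nra.
  apply: (le_trans (H _)); rewrite lerD2r /vnorm2.
  have h0 := sqr_ge0 (normc (v 0 0)); have h1 := sqr_ge0 (normc (v 0 1)).
  have h2 := sqr_ge0 (normc (v 0 2)).
  case: i => -[|[|[|//]]] h.
  - by rewrite (_ : Ordinal h = 0) ?lerDl; [lra|exact: val_inj].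
  - by rewrite (_ : Ordinal h = 1); [lra|exact: val_inj].
  - by rewrite (_ : Ordinal h = 2); [lra|exact: val_inj].
have [K K0 HK] := orbit_vec_lip A.
have r0 : 0 < 1 - normc m0 by rewrite subr_gt0.
have kr0 : 0 < normc k0 * (1 - normc m0) by rewrite mulr_gt0// normc_gt0.
(* C1 is a Lipschitz constant of the parameter m as a function of the vector *)
have [C1 C10 HC1] : exists2 C1, 0 <= C1 & forall w m k d, 0 <= d ->
    (forall i, lip d A 1 (w 0 i) (v 0 i)) -> joukowski w m k -> normc m <= 1 ->
    normc (m - m0) <= C1 * d.
  have [B1 [c1 H1]] : exists B c, forall w d, 0 <= d ->
      (forall i, lip d A 1 (w 0 i) (v 0 i)) ->
      lip d B c (w 0 1 * w 0 2) (v 0 1 * v 0 2).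
    by eexists; eexists => w d d0 hv; apply: lipM.
  have [B2 [c2 H2]] : exists B c, forall w d, 0 <= d ->
      (forall i, lip d A 1 (w 0 i) (v 0 i)) ->
      lip d B c (w 0 0 ^+ 2 - w 0 1 ^+ 2 - w 0 2 ^+ 2)
                (v 0 0 ^+ 2 - v 0 1 ^+ 2 - v 0 2 ^+ 2).
    eexists; eexists => w d d0 hv; rewrite !expr2.
    by do ![exact: hv|apply: lipM|apply: lipD|apply: lipN].
  exists ((2 * `|c1| + `|c2|) / (normc k0 * (1 - normc m0))).
    by rewrite divr_ge0 ?(ltW kr0)// addr_ge0// mulr_ge0.
  move=> w m k d d0 hv jw m1.
  have [_ _ h1] := H1 _ _ d0 hv; have [_ _ h2] := H2 _ _ d0 hv.
  have := joukowski_stable jv jw m01 m1.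
  rewrite ![normc (_ - (w 0 1 * w 0 2))]normc_distC [X in _ <= _ + X]normc_distC => H.
  rewrite mulrAC ler_pdivlMr// mulrC; apply: le_trans H _.
  have n1 : c1 * d <= `|c1| * d by rewrite ler_wpM2r// ler_norm.
  have n2 : c2 * d <= `|c2| * d by rewrite ler_wpM2r// ler_norm.
  lra.
pose C3 := 1 + C1 + C1 / (1 - normc m0).
have C30 : 0 <= C1 / (1 - normc m0) by rewrite divr_ge0// ltW.
have [d [d0 d1 dm dK]] : exists d, [/\ 0 < d, d <= 1, C1 * d < 1 - normc m0 &
    K * (C3 * d) ^+ 2 < kap * c].
  pose L := K * C3 ^+ 2.
  have L0 : 0 <= L by rewrite mulr_ge0 ?sqr_ge0// ltW.
  have kc : 0 < kap * c by rewrite mulr_gt0.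
  pose d := Num.min 1 (Num.min ((1 - normc m0) / (C1 + 1)) (kap * c / (L + 1))).
  have d0 : 0 < d.
    by rewrite !lt_min ltr01 !divr_gt0// ltr_wpDl.
  have d1 : d <= 1 by rewrite ge_min lexx.
  have h1 : d * (C1 + 1) <= 1 - normc m0.
    by rewrite -ler_pdivlMr ?ltr_wpDl// !ge_min lexx !orbT.
  have h2 : d * (L + 1) <= kap * c.
    by rewrite -ler_pdivlMr ?ltr_wpDl// !ge_min lexx !orbT.
  exists d; split=> //; first lra.
  rewrite exprMn mulrA -/L.
  have : L * d ^+ 2 <= L * d by rewrite ler_wpM2l// expr2 ler_piMr// ltW.
  lra.
have d20 : 0 < d ^+ 2 by rewrite exprn_gt0.
have [eta eta0 Heta] := mdist_near_coords (coords_neq0 vp) d20.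
exists [set q | mdist p q < eta]; first exact: mdist_nbhs.
move=> n; apply: (@diam_lt _ _ (iter n (@F R) p)) => // _ [q [pq qE] <-].
have [w wq wv] := Heta _ _ vp pq.
have [m [k [jw m1]]] := joukowski_exists w.
have hv i : lip d A 1 (w 0 i) (v 0 i).
  have wvi : normc (w 0 i - v 0 i) <= d.
    rewrite -(@ler_pXn2r _ 2)// ?nnegrE ?normc_ge0 ?(ltW d0)//.
    apply: le_trans (ltW wv); rewrite /vnorm2 !mxE.
    have h0 := sqr_ge0 (normc (w 0 0 - v 0 0)).
    have h1 := sqr_ge0 (normc (w 0 1 - v 0 1)).
    have h2 := sqr_ge0 (normc (w 0 2 - v 0 2)).
    case: i => -[|[|[|//]]] h.
    - by rewrite (_ : Ordinal h = 0); [lra|exact: val_inj].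
    - by rewrite (_ : Ordinal h = 1); [lra|exact: val_inj].
    - by rewrite (_ : Ordinal h = 2); [lra|exact: val_inj].
  have := vA i; rewrite /A => vAi; split; [|lra|by rewrite mul1r].
  have := le_normcD (w 0 i - v 0 i) (v 0 i); rewrite subrK; lra.
have mm := HC1 _ _ _ _ (ltW d0) hv jw m1.
have m1' : normc m < 1.
  have := le_normcD (m - m0) m0; rewrite subrK; lra.
have C3d : d <= C3 * d /\ C1 * d <= C3 * d /\ C1 / (1 - normc m0) * d <= C3 * d.
  by rewrite /C3; do 2?split; nra.
have hv' i : lip (C3 * d) A 1 (w 0 i) (v 0 i).
  by have [h1 h2 h3] := hv i; split=> //; lra.
have hm : lip (C3 * d) 1 1 m m0.
  by split; rewrite ?(ltW m01)// mul1r; lra.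
have C3d0 : 0 <= C3 * d by lra.
pose M := m ^+ (2 ^ n).-1; pose M0 := m0 ^+ (2 ^ n).-1.
have M01 : normc M0 <= 1 by rewrite normcX exprn_ile1 ?normc_ge0// ltW.
have hM : lip (C3 * d) 1 1 M M0.
  split=> //; first by rewrite normcX exprn_ile1 ?normc_ge0.
  rewrite mul1r; apply: le_trans (normc_expB _ m01 m1) _.
  apply: (@le_trans _ _ (C1 / (1 - normc m0) * d)); last by lra.
  by rewrite mulrAC ler_wpM2r// invr_ge0 ltW.
have near := HK _ _ _ _ _ _ _ C3d0 hv' hm hM.
apply: (Hkap _ _ _ _ (coords_iter n vp pE (normc_lt1_sq m01) jv)
  (coords_iter n wq qE (normc_lt1_sq m1') jw)).
apply: le_lt_trans near _; apply: lt_le_trans dK _.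
by rewrite ler_wpM2l ?(ltW kap0)//; exact: Hc.
Qed.

End FatouJulia.

(** * Failure of equicontinuity on the spectrum *)

Section JuliaOn.
Variable R : realType.
Local Notation C := R[i].
Implicit Types (u v w z : 'rV[C]_3) (p q : P2 R) (m k M : C).

(** Of the two square roots b and -b of c one satisfies |b - a| <= |b + a|,
    while (b - a) (b + a) = c - a^2. *)
Lemma sqrt_near (a c : C) :
  exists2 b, b ^+ 2 = c & normc (b - a) ^+ 2 <= normc (c - a ^+ 2).
Proof.
pose s := sqrtC c; have s2 : s ^+ 2 = c by rewrite sqrtCK.
have E : normc (c - a ^+ 2) = normc (s - a) * normc (s + a).
  by rewrite -normcM -s2; congr normc; ring.
have h1 := normc_ge0 (s - a); have h2 := normc_ge0 (s + a).
have [le|lt] := leP (normc (s - a)) (normc (s + a)).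
  by exists s => //; rewrite E; nra.
exists (- s); first by rewrite sqrrN.
rewrite -opprD normcN E; nra.
Qed.

(** Moving z0 alone, to a square root of z1^2 + z2^2 + 2 z1 z2 y, changes the
    value x of Q / (2 z1 z2) into any prescribed y. *)
Lemma spectrum_perturb v (x : R) (y : C) :
  v 0 0 ^+ 2 - v 0 1 ^+ 2 - v 0 2 ^+ 2 = 2 * (v 0 1 * v 0 2) * (x%:C)%C ->
  exists w, [/\ w 0 1 = v 0 1, w 0 2 = v 0 2,
    w 0 0 ^+ 2 - w 0 1 ^+ 2 - w 0 2 ^+ 2 = 2 * (w 0 1 * w 0 2) * y &
    vnorm2 (w - v) <= normc (2 * (v 0 1 * v 0 2)) * normc (y - (x%:C)%C)].
Proof.
move=> h; have [b b2 bn] := sqrt_near (v 0 0)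
   (v 0 1 ^+ 2 + v 0 2 ^+ 2 + 2 * (v 0 1 * v 0 2) * y).
exists (vec3 b (v 0 1) (v 0 2)); rewrite !vec3_0 !vec3_1 !vec3_2; split=> //.
  by rewrite b2; ring.
rewrite /vnorm2 !mxE /= -normcM !subrr !normc0 expr0n/= !addr0.
apply: le_trans bn _; rewrite le_eqVlt; apply/orP; left; apply/eqP.
congr normc; rewrite mulrBr -h; ring.
Qed.

(** Where z1 z2 = 0, membership in a spectral conic means Q = 0; these four
    points are indeterminate. *)
Lemma spectrum_axis_indet v : on_spectral_conic v -> v 0 1 * v 0 2 = 0 -> F_poly v = 0.
Proof.
move=> [x _ hx] b0; move: hx; rewrite F_polyE b0 mulr0 mul0r => hx.
rewrite hx mulr0.
have [E|E] : v 0 1 = 0 \/ v 0 2 = 0.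
  by move/eqP: b0; rewrite mulf_eq0 => /orP[] /eqP; [left|right].
- rewrite E expr0n mul0r.
  have -> : v 0 0 ^+ 2 - v 0 2 ^+ 2 = 0 by rewrite -hx E; ring.
  by rewrite mulr0; apply/rowP => i; rewrite !mxE; case: i => -[|[|[|//]]].
- by rewrite E mulr0 mul0r; apply/rowP => i; rewrite !mxE; case: i => -[|[|[|//]]].
Qed.

(** When m^N = 1 the orbit has reached the fixed point [0 : 1 : -1]. *)
Lemma orbit_vec_root w (om : C) n : om ^+ (2 ^ n) = 1 ->
  orbit_vec (om ^+ (2 ^ n).-1) w om =
  (w 0 1 * (1 - om ^+ 2) * om ^+ (2 ^ n).-1) *: vec3 0 1 (- 1).
Proof.
move=> omn; set M := om ^+ _.
have omM : om * M = 1 by rewrite -exprS prednK// expn_gt0.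
apply/rowP => i; rewrite !mxE; case: i => -[|[|[|//]]] ? /=.
- by rewrite -exprMn omM expr1n subrr !mulr0.
- by rewrite mulr1.
- have -> : om * M ^+ 2 * (om * w 0 2 + w 0 1) =
      (om * M) ^+ 2 * w 0 2 + (om * M) * (M * w 0 1) by ring.
  rewrite omM expr1n !mul1r.
  have -> : w 0 1 * (1 - om ^+ 2) * M * -1 = w 0 1 * (om * (om * M) - M) by ring.
  by rewrite omM; ring.
Qed.

(** Points with |m| < 1 are attracted by the line z1 = 0. *)
Lemma orbit_vec_second_small w m (c : R) : normc m < 1 -> 0 < c ->
  exists n0, forall n, (n0 <= n)%N ->
    8 * normc (orbit_vec (m ^+ (2 ^ n).-1) w m 0 1) ^+ 2 < c.
Proof.
move=> m1 c0; have m0 := normc_ge0 m.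
pose G := normc (w 0 1) ^+ 2 * 4 + 1.
have g0 := sqr_ge0 (normc (w 0 1)).
have G0 : 0 < G by rewrite ltr_wpDl// mulr_ge0.
have eps0 : 0 < Num.min 1 (c / 8 / G) by rewrite lt_min ltr01 !divr_gt0.
have [n0 Hn] := pow_small (r := normc m) (andb_true_intro (conj m0 m1)) eps0.
exists n0 => n /Hn; rewrite lt_min -(normcX m); set M := m ^+ _ => /andP[M1 Md].
have M0 := normc_ge0 M.
rewrite /orbit_vec vec3_1 !normcM !exprMn.
have h : normc (1 - m ^+ 2) <= 2.
  apply: le_trans (le_normcB _ _) _; rewrite normc_one normcX; nra.
have h0 := normc_ge0 (1 - m ^+ 2).
have h4 : normc (1 - m ^+ 2) ^+ 2 <= 4 by nra.
have M2 : normc M ^+ 2 <= normc M by nra.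
have MG : normc M * G < c / 8 by rewrite -ltr_pdivlMr.
have : normc (w 0 1) ^+ 2 * normc (1 - m ^+ 2) ^+ 2 * normc M ^+ 2 <=
    normc (w 0 1) ^+ 2 * 4 * normc M.
  apply: ler_pM => //; [by rewrite mulr_ge0 ?sqr_ge0|exact: sqr_ge0|].
  by rewrite ler_wpM2l.
rewrite /G in MG; lra.
Qed.

(** Any coordinates close to (0, 1, -1) stay away from the line z1 = 0;
    together with [orbit_vec_second_small] this separates two orbits at a
    scale that does not depend on them. *)
Lemma second_large (u : 'rV[C]_3) :
  vnorm2 (u - vec3 0 1 (- 1)) < 1 / 16 -> vnorm2 u <= 8 * normc (u 0 1) ^+ 2.
Proof.
rewrite /vnorm2 !mxE /= subr0 opprK.
have l0 := normc_ge0 (u 0 0); have l1 := normc_ge0 (u 0 1).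
have l2 := normc_ge0 (u 0 2).
have : 1 <= normc (u 0 1) + normc (u 0 1 - 1).
  have := le_normcB (u 0 1) (u 0 1 - 1).
  have -> : u 0 1 - (u 0 1 - 1) = 1 by ring.
  by rewrite normc_one.
have : normc (u 0 2) <= normc (u 0 2 + 1) + 1.
  by have := le_normcB (u 0 2 + 1) 1; rewrite addrK normc_one.
have := normc_ge0 (u 0 1 - 1); have := normc_ge0 (u 0 2 + 1).
move: (normc (u 0 1 - 1)) (normc (u 0 2 + 1)) l0 l1 l2.
move: (normc (u 0 0)) (normc (u 0 1)) (normc (u 0 2)).
move=> f g h g' h' f0 g0 h0 h'0 g'0 hh gg sm.
have g4 : g' <= 1 / 4 by nra.
have h4 : h' <= 1 / 4 by nra.
have f4 : f ^+ 2 <= 1 / 16 by nra.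
have g3 : 3 / 4 <= g by lra.
have h5 : h <= 5 / 4 by lra.
nra.
Qed.

(** Arbitrarily close to v there are vectors whose parameter m is a root of
    unity of order a power of 2, and vectors whose parameter satisfies |m| <
    1. After enough iterations the former sit at [0 : 1 : -1] and the latter
    are close to the line z1 = 0, so the diameters of the images of a
    neighborhood do not become small. *)
Lemma not_fatou_on_spectrum v p : coords v p ->
  on_spectral_conic v -> ~ ext_indet R p -> ~ fatou_point p.
Proof.
move=> vp [x x1 hx] pE [_ fp].
have b0 : v 0 1 * v 0 2 != 0.
  apply/eqP => b0; apply: (ext_indet_iter (n := 0%N) pE).
  apply/(coords_indet vp)/spectrum_axis_indet => //; by exists x.
have [v1 v2] : v 0 1 != 0 /\ v 0 2 != 0.
  by move: b0; rewrite mulf_eq0 negb_or => /andP.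
pose a : 'rV[C]_3 := vec3 0 1 (- 1).
have a0 : a != 0.
  by apply/eqP => /rowP /(_ 1); rewrite vec3_1 mxE => /eqP; rewrite oner_eq0.
have d16 : 0 < 1 / 16 :> R by rewrite divr_gt0.
have [e e0 He] := mdist_near_coords a0 d16.
have [U nU Ue] := fp e e0.
have [eU eU0 HU] := nbhs_mdist nU.
have [kU kU0 HkU] := mdist_lt eU0.
have [d2 d20 Hd2] := ext_indet_near vp pE.
have vn := vnorm2_gt0 (coords_neq0 vp).
pose d := Num.min d2 (kU * vnorm2 v).
have d0 : 0 < d by rewrite lt_min d20 mulr_gt0.
have Hd w q : vnorm2 (w - v) < d -> coords w q -> U q /\ ~ ext_indet R q.
  rewrite lt_min => /andP[wd wU] wq; split; last exact: Hd2 wq.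
  by apply: HU; exact: HkU vp wq wU.
(* a shift of Q / (2 z1 z2) by less than t moves v by less than d *)
pose B := normc (2 * (v 0 1 * v 0 2)).
have B0 : 0 < B by rewrite normc_gt0// mulf_neq0// pnatr_eq0.
pose t := d / B; have t0 : 0 < t by rewrite divr_gt0.
have neq0 w : w 0 1 = v 0 1 -> w != 0.
  by move=> E; apply: contraNneq v1 => w0; rewrite -E w0 mxE.
(* q lands on [0 : 1 : -1]: its parameter om has order a power of 2 *)
have [j [om [omj om2 omx]]] := dyadic_root_dense x1 t0.
have om1 : normc om = 1 by apply: (normc_root _ omj); rewrite expn_gt0.
have om0 : om != 0.
  by apply/eqP => E; move: om1; rewrite E normc0 => /esym/eqP; rewrite oner_eq0.
have [w [w1 w2 hw wd]] := spectrum_perturb ((complex.Re om)%:C)%C hx.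
have {}wd : vnorm2 (w - v) < d.
  apply: le_lt_trans wd _; rewrite -(rmorphB (real_complex R)) normc_real.
  by rewrite mulrC -ltr_pdivlMr.
have [q wq] := coords_exists (neq0 _ w1).
have [Uq qE] := Hd _ _ wd wq.
have jw : joukowski w om (w 0 1 * w 0 2 / om).
  split; first by rewrite divfK.
  by rewrite hw Re_unit//; field.
have orbq n : (j <= n)%N -> coords a (iter n (@F R) q).
  move=> jn; have omn : om ^+ (2 ^ n) = 1.
    by rewrite -(subnKC jn) expnD exprM omj expr1n.
  have := coords_iter n wq qE om2 jw.
  rewrite orbit_vec_root//; set s := w 0 1 * _ * _.
  have s0 : s != 0.
    by rewrite !mulf_neq0 ?w1 ?expf_neq0// subr_eq0 eq_sym.
  have := @coordsZ R s^-1 (s *: a) (iter n (@F R) q).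
  by rewrite invr_eq0 scalerA mulVf// scale1r; exact.
(* q' is attracted by the line z1 = 0: its value x + i t / 2 of Q / (2 z1 z2)
   is not real *)
have [w' [w1' w2' hw' wd']] := spectrum_perturb (x +i* (t / 2))%C hx.
have {}wd' : vnorm2 (w' - v) < d.
  apply: le_lt_trans wd' _; rewrite -/B.
  have -> : normc ((x +i* (t / 2))%C - (x%:C)%C) = t / 2.
    rewrite /= subrr subr0 expr0n add0r sqrtr_sqr ger0_norm//.
    by rewrite divr_ge0// ltW.
  rewrite mulrC -ltr_pdivlMr// -/t; lra.
have nS : ~ on_spectral_conic w'.
  move=> [x' _]; rewrite hw' w1' w2'.
  have c0 : 2 * (v 0 1 * v 0 2) != 0 :> C by rewrite mulf_neq0// pnatr_eq0.
  move=> /(mulfI c0) /(congr1 (@complex.Im R)) /= t20.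
  lra.
have [m [k [jw' m1 k0]]] := joukowski_lt1 nS.
have [q' wq'] := coords_exists (neq0 _ w1').
have [Uq' qE'] := Hd _ _ wd' wq'.
have m0 := normc_ge0 m.
have [c c0 Hc] : exists2 c, 0 < c &
    forall M, normc M <= 1 -> c <= vnorm2 (orbit_vec M w' m).
  by apply: (orbit_vec_lower jw' m1) => -[/(degenerate_ext_indet wq' m1) H /H].
have [n0 Hn] := orbit_vec_second_small w' m1 c0.
pose n := maxn n0 j.
have aq : coords a (iter n (@F R) q) by apply: orbq; exact: leq_maxr.
have oq' := coords_iter n wq' qE' (normc_lt1_sq m1) jw'.
have dist : mdist (iter n (@F R) q) (iter n (@F R) q') < e.
  by apply: (mdist_diam (Ue n)); [exists q|exists q'].
have [u uq' un] := He _ _ aq dist.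
have [s s0 us] := coords_inj oq' uq'.
have := second_large un; rewrite us vnorm2Z mxE normcM exprMn mulrCA.
rewrite ler_pM2l ?exprn_gt0 ?normc_gt0//; apply/negP; rewrite -ltNge.
apply: lt_le_trans (Hn n (leq_maxl _ _)) (Hc _ _).
by rewrite normcX exprn_ile1 ?normc_ge0// ltW.
Qed.

End JuliaOn.

(** * Square-integrable functions and bounded operators *)

Section SquareIntegral.
Context d (T : measurableType d) (R : realType).
Variable mu : {measure set T -> \bar R}.
Local Notation C := R[i].
Implicit Types (f g : T -> C).
Local Open Scope ereal_scope.

Definition sqnorm f (x : T) : \bar R := (normc (f x) ^+ 2)%:E.
(** The square of [L2norm], which spares the roots in all estimates. *)
Definition energy f : \bar R := \int[mu]_x sqnorm f x.

Definition cmeasurable f :=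
  measurable_fun setT (fun x => complex.Re (f x)) /\
  measurable_fun setT (fun x => complex.Im (f x)).

Lemma sqnorm_ge0 f x : 0 <= sqnorm f x.
Proof. by rewrite lee_fin sqr_ge0. Qed.

Lemma energy_ge0 f : 0 <= energy f.
Proof. by apply: integral_ge0 => x _; exact: sqnorm_ge0. Qed.

Lemma measurable_sqnorm f : cmeasurable f -> measurable_fun setT (sqnorm f).
Proof.
move=> [mr mi]; apply/measurable_EFinP.
rewrite (_ : (fun x => _) = (fun x => complex.Re (f x) ^+ 2 + complex.Im (f x) ^+ 2)%R).
  by apply: measurable_funD; apply: measurable_funX.
by apply/funext => x; rewrite normc_sqE.
Qed.

Lemma L2normE f : L2norm mu f = energy f `^ 2^-1.
Proof.
rewrite /L2norm unlock; congr (_ `^ _); apply: eq_integral => x _.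
by rewrite abse_EFin ger0_norm ?normc_ge0// poweR_EFin powR_mulrn ?normc_ge0.
Qed.

Lemma L2norm_sq f : L2norm mu f `^ 2 = energy f.
Proof.
rewrite /L2norm poweR_Lnorm//; apply: eq_integral => x _.
by rewrite abse_EFin ger0_norm ?normc_ge0// poweR_EFin powR_mulrn ?normc_ge0.
Qed.

Lemma L2P f : L2 mu f <-> cmeasurable f /\ energy f < +oo.
Proof.
split=> [[mr mi fi]|[[mr mi] fi]]; split=> //.
  by rewrite -L2norm_sq; exact: poweR_lty.
by rewrite L2normE; exact: poweR_lty.
Qed.

Lemma le_L2norm (K : R) f g : (0 <= K)%R ->
  energy f <= (K ^+ 2)%:E * energy g -> L2norm mu f <= K%:E * L2norm mu g.
Proof.
move=> K0 fg; rewrite !L2normE.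
apply: (@le_trans _ _ (((K ^+ 2)%:E * energy g) `^ 2^-1)).
  apply: gt0_ler_poweR => //; rewrite in_itv/= leey andbT ?energy_ge0//.
  by rewrite mule_ge0 ?energy_ge0// lee_fin sqr_ge0.
rewrite poweRM ?energy_ge0 ?lee_fin ?sqr_ge0//.
by rewrite poweR_EFin -powR_mulrn// -powRrM mulfV// powRr1.
Qed.

Lemma le_energy (K : R) f g : (0 <= K)%R ->
  L2norm mu f <= K%:E * L2norm mu g -> energy f <= (K ^+ 2)%:E * energy g.
Proof.
move=> K0 fg; rewrite -!L2norm_sq.
apply: (@le_trans _ _ ((K%:E * L2norm mu g) `^ 2)).
  apply: gt0_ler_poweR => //; rewrite in_itv/= leey andbT ?Lnorm_ge0//.
  by rewrite mule_ge0 ?Lnorm_ge0// lee_fin.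
rewrite poweRM ?Lnorm_ge0 ?lee_fin//.
by rewrite poweR_EFin powR_mulrn.
Qed.

Lemma cmeasurable_lin (c : C) f g : cmeasurable f -> cmeasurable g ->
  cmeasurable (fun x => c * f x + g x)%R.
Proof.
move=> [fr fi] [gr gi]; split.
  rewrite (_ : (fun x => _) = (fun x => (complex.Re c * complex.Re (f x) -
     complex.Im c * complex.Im (f x)) + complex.Re (g x))%R).
    apply: measurable_funD => //; apply: measurable_funB;
      by apply: measurable_funM => //; exact: measurable_cst.
  by apply/funext => x; case: (c) => c1 c2; case: (f x) => f1 f2; case: (g x) => g1 g2.
rewrite (_ : (fun x => _) = (fun x => (complex.Re c * complex.Im (f x) +
     complex.Im c * complex.Re (f x)) + complex.Im (g x))%R).
  apply: measurable_funD => //; apply: measurable_funD;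
    by apply: measurable_funM => //; exact: measurable_cst.
by apply/funext => x; case: (c) => c1 c2; case: (f x) => f1 f2; case: (g x) => g1 g2.
Qed.

Lemma normc_lin_sq (c a b : C) :
  (normc (c * a + b) ^+ 2 <= 2 * normc c ^+ 2 * normc a ^+ 2 + 2 * normc b ^+ 2)%R.
Proof.
have := le_normcD (c * a)%R b; rewrite normcM.
have := normc_ge0 (c * a + b)%R.
move: (normc (_ + _)%R) => y y0 H.
apply: (@le_trans _ _ ((normc c * normc a + normc b) ^+ 2)%R).
  by rewrite lerXn2r ?nnegrE// (le_trans y0).
have := sqr_ge0 (normc c * normc a - normc b)%R; lra.
Qed.

Lemma energy_lin (c : C) f g : cmeasurable f -> cmeasurable g ->
  energy (fun x => c * f x + g x)%R <=
  (2 * normc c ^+ 2)%:E * energy f + 2%:E * energy g.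
Proof.
move=> mf mg; have sf := measurable_sqnorm mf; have sg := measurable_sqnorm mg.
have c0 : (0 <= 2 * normc c ^+ 2)%R by rewrite mulr_ge0// sqr_ge0.
rewrite /energy -ge0_integralZl//; last by move=> x _; exact: sqnorm_ge0.
rewrite -ge0_integralZl//; last by move=> x _; exact: sqnorm_ge0.
rewrite -ge0_integralD//.
- apply: ge0_le_integral => //.
  + by move=> x _; exact: sqnorm_ge0.
  + exact: measurable_sqnorm (cmeasurable_lin c mf mg).
  + by apply: emeasurable_funD; exact: measurable_funeM.
  + by move=> x _; rewrite /sqnorm -!EFinM -EFinD lee_fin normc_lin_sq.
- by move=> x _; rewrite mule_ge0// ?sqnorm_ge0// lee_fin.
- exact: measurable_funeM.
- by move=> x _; rewrite mule_ge0// ?sqnorm_ge0// lee_fin.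
- exact: measurable_funeM.
Qed.

Lemma L2_lin (c : C) f g : L2 mu f -> L2 mu g -> L2 mu (fun x => c * f x + g x)%R.
Proof.
move=> /L2P[mf fi] /L2P[mg gi]; apply/L2P; split; first exact: cmeasurable_lin.
apply: le_lt_trans (energy_lin c mf mg) _.
by rewrite lte_add_pinfty// lte_mul_pinfty// ?energy_ge0// lee_fin// mulr_ge0// sqr_ge0.
Qed.

Lemma aeP (V : T -> Type) (f g : forall x, V x) :
  f = g %[ae mu] <-> \forall x \ae mu, f x = g x.
Proof. by split; apply: filterS => x /=; [apply|]. Qed.

Lemma energy_eq0 f : cmeasurable f ->
  energy f = 0 <-> \forall x \ae mu, f x = 0%R.
Proof.
move=> mf; have := ae_eq_integral_abs mu measurableT (measurable_sqnorm mf).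
have -> : \int[mu]_x `|sqnorm f x| = energy f.
  by apply: eq_integral => x _; rewrite gee0_abs// sqnorm_ge0.
move=> ->; split.
  apply: filterS => x /= /(_ I) [/eqP]; rewrite expf_eq0/= => /eqP; exact: eq0_normc.
by apply: filterS => x fx _; rewrite /sqnorm fx normc0 expr0n.
Qed.

Lemma L2_0 : L2 mu (fun=> 0%R).
Proof.
apply/L2P; split; first by split; exact: measurable_cst.
rewrite (_ : energy _ = 0) ?ltry//.
by apply: integral0_eq => x _; rewrite /sqnorm normc0 expr0n.
Qed.

Implicit Types A B : (T -> C) -> (T -> C).

Lemma bounded_energy A : bounded_operator mu A -> exists2 K, (0 <= K)%R &
  forall f, L2 mu f -> energy (A f) <= K%:E * energy f.
Proof.
move=> [_ _ [M HM]]; exists (Num.max M 0 ^+ 2)%R; first exact: sqr_ge0.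
have K0 : (0 <= Num.max M 0)%R by rewrite le_max lexx orbT.
move=> f fL; apply: le_energy => //; apply: le_trans (HM f fL) _.
by rewrite lee_wpmul2r ?Lnorm_ge0// lee_fin le_max lexx.
Qed.

Lemma bounded_operatorI A (K : R) : (0 <= K)%R ->
  (forall f, L2 mu f -> cmeasurable (A f)) ->
  (forall (c : C) f g, L2 mu f -> L2 mu g ->
     \forall x \ae mu, A (fun x => c * f x + g x)%R x = (c * A f x + A g x)%R) ->
  (forall f, L2 mu f -> energy (A f) <= K%:E * energy f) ->
  bounded_operator mu A.
Proof.
move=> K0 mA linA EA; split.
- move=> f fL; apply/L2P; split; first exact: mA.
  apply: le_lt_trans (EA f fL) _; rewrite lte_mul_pinfty//.
  by case/L2P: fL.
- by move=> c f g fL gL; apply/aeP; exact: linA.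
- exists (Num.sqrt K) => f fL; apply: le_L2norm; first exact: sqrtr_ge0.
  by rewrite sqr_sqrtr//; exact: EA.
Qed.

Lemma operator_lin A (c : C) f g : bounded_operator mu A -> L2 mu f -> L2 mu g ->
  \forall x \ae mu, A (fun x => c * f x + g x)%R x = (c * A f x + A g x)%R.
Proof. by move=> [_ H _] fL gL; apply/aeP; exact: H. Qed.

(** By linearity A f - A g = A (f - g) almost everywhere, and a bounded
    operator sends a null function to a null function. *)
Lemma operator_ae A f g : bounded_operator mu A -> L2 mu f -> L2 mu g ->
  (\forall x \ae mu, f x = g x) -> \forall x \ae mu, A f x = A g x.
Proof.
move=> bA fL gL fg; pose h x := (-1 * g x + f x)%R.
have hL : L2 mu h by exact: L2_lin.
have h0 : energy h = 0.
  apply/energy_eq0; first by case/L2P: hL.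
  by apply: filterS fg => x fgx; rewrite /h fgx mulN1r addNr.
have [K K0 HK] := bounded_energy bA.
have Ah0 : energy (A h) = 0.
  apply/eqP; rewrite eq_le energy_ge0 andbT.
  by apply: le_trans (HK _ hL) _; rewrite h0 mule0.
have AhL : L2 mu (A h) by case: bA => + _ _; exact.
move/energy_eq0 : Ah0 => /(_ (proj1 (proj1 (L2P _) AhL))) Ah.
have lin := operator_lin (-1)%R bA gL fL.
apply: filterS2 Ah lin => x H1 H2.
by apply/eqP; rewrite -subr_eq0 addrC -mulN1r -H2 H1.
Qed.

Lemma operator_L2 A f : bounded_operator mu A -> L2 mu f -> L2 mu (A f).
Proof. by move=> [+ _ _]; exact. Qed.

Lemma bounded_id : bounded_operator mu id.
Proof.
apply: (@bounded_operatorI id 1%R) => //; first by move=> f /L2P[].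
- by move=> c f g _ _; exact: nearW.
- by move=> f _; rewrite mul1e.
Qed.

Lemma bounded_comp A B : bounded_operator mu A -> bounded_operator mu B ->
  bounded_operator mu (A \o B).
Proof.
move=> bA bB; have [K K0 HK] := bounded_energy bA.
have [M M0 HM] := bounded_energy bB.
apply: (@bounded_operatorI _ (K * M)%R); first exact: mulr_ge0.
- by move=> f fL; case/L2P: (operator_L2 bA (operator_L2 bB fL)).
- move=> c f g fL gL /=.
  have H1 := operator_ae bA (operator_L2 bB (L2_lin c fL gL))
    (L2_lin c (operator_L2 bB fL) (operator_L2 bB gL)) (operator_lin c bB fL gL).
  have H2 := operator_lin c bA (operator_L2 bB fL) (operator_L2 bB gL).
  by apply: filterS2 H1 H2 => x -> ->.
- move=> f fL /=; apply: le_trans (HK _ (operator_L2 bB fL)) _.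
  by rewrite EFinM -muleA lee_wpmul2l ?lee_fin//; exact: HM.
Qed.

Lemma bounded_lin (c : C) A B : bounded_operator mu A -> bounded_operator mu B ->
  bounded_operator mu (fun f x => c * A f x + B f x)%R.
Proof.
move=> bA bB; have [K K0 HK] := bounded_energy bA.
have [M M0 HM] := bounded_energy bB.
have c0 : (0 <= 2 * normc c ^+ 2)%R by rewrite mulr_ge0// sqr_ge0.
apply: (@bounded_operatorI _ (2 * normc c ^+ 2 * K + 2 * M)%R).
- by rewrite addr_ge0// mulr_ge0.
- move=> f fL; case/L2P: (L2_lin c (operator_L2 bA fL) (operator_L2 bB fL)) => //.
- move=> e f g fL gL.
  have H1 := operator_lin e bA fL gL; have H2 := operator_lin e bB fL gL.
  by apply: filterS2 H1 H2 => x -> ->; ring.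
- move=> f fL; have [mA _] := (L2P _).1 (operator_L2 bA fL).
  have [mB _] := (L2P _).1 (operator_L2 bB fL).
  apply: le_trans (energy_lin c mA mB) _.
  have fi : energy f \is a fin_num by rewrite ge0_fin_numE ?energy_ge0//; case/L2P: fL.
  rewrite (EFinD (_ * K)%R) muleDl// [(_ * K)%:E]EFinM [(2 * M)%:E]EFinM -!muleA.
  by rewrite leeD// lee_wpmul2l ?HK ?HM.
Qed.

Lemma bounded_zero : bounded_operator mu (fun _ _ => 0%R).
Proof.
apply: (@bounded_operatorI _ 0%R) => //.
- by move=> c f g _ _; apply: nearW => x; rewrite mulr0 addr0.
- move=> f _; rewrite mul0e /energy integral0_eq// => x _.
  by rewrite /sqnorm normc0 expr0n.
Qed.

Lemma bounded_scale (c : C) A : bounded_operator mu A ->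
  bounded_operator mu (fun f x => c * A f x)%R.
Proof.
move=> bA; rewrite (_ : (fun f x => _) = (fun f x => c * A f x + 0)%R).
  exact: (bounded_lin c bA bounded_zero).
by apply/funext => f; apply/funext => x; rewrite addr0.
Qed.

(** As in any monoid, a left inverse B and a right inverse B' coincide: B f =
    B (A (B' f)) = B' f, up to null sets. *)
Lemma invertible_of_sides A B B' : bounded_operator mu A ->
  bounded_operator mu B -> bounded_operator mu B' ->
  (forall f, L2 mu f -> \forall x \ae mu, B (A f) x = f x) ->
  (forall f, L2 mu f -> \forall x \ae mu, A (B' f) x = f x) ->
  invertible_operator mu A.
Proof.
move=> bA bB bB' BA AB; exists B; split=> // f fL.
split; apply/aeP; last exact: BA.
have B'L := operator_L2 bB' fL; have AB'L := operator_L2 bA B'L.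
have H1 := operator_ae bB AB'L fL (AB f fL).
have H2 := BA _ B'L.
have H3 : \forall x \ae mu, B f x = B' f x.
  by apply: filterS2 H1 H2 => x <- ->.
have H4 := operator_ae bA (operator_L2 bB fL) B'L H3.
by apply: filterS2 H4 (AB f fL) => x -> ->.
Qed.

End SquareIntegral.

(** * Complex series *)

Section ComplexSeries.
Variable R : realType.
Local Notation C := R[i].
Implicit Types (u v : nat -> C) (c s : C).

Definition psum u n : C := \sum_(0 <= k < n) u k.

Definition csummable u := cvgn (series (fun n => normc (u n))).

(** Real and imaginary parts are summed separately, so that the theory of real
    series applies. *)
Definition csum u : C :=
  (limn (fun n => complex.Re (psum u n)) +i* limn (fun n => complex.Im (psum u n)))%C.

Lemma psumS u n : psum u n.+1 = psum u n + u n.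
Proof. by rewrite /psum big_nat_recr. Qed.

Lemma Re_psum u n : complex.Re (psum u n) = series (fun k => complex.Re (u k)) n.
Proof.
rewrite /series/=; elim: n => [|n IH]; first by rewrite /psum !big_geq.
by rewrite psumS big_nat_recr//= -IH; case: (psum u n); case: (u n).
Qed.

Lemma Im_psum u n : complex.Im (psum u n) = series (fun k => complex.Im (u k)) n.
Proof.
rewrite /series/=; elim: n => [|n IH]; first by rewrite /psum !big_geq.
by rewrite psumS big_nat_recr//= -IH; case: (psum u n); case: (u n).
Qed.

Lemma normc_ge_Re c : `|complex.Re c| <= normc c.
Proof.
by case: c => a b /=; rewrite -sqrtr_sqr ler_sqrt ?addr_ge0 ?sqr_ge0// lerDl sqr_ge0.
Qed.

Lemma normc_ge_Im c : `|complex.Im c| <= normc c.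
Proof.
by case: c => a b /=; rewrite -sqrtr_sqr ler_sqrt ?addr_ge0 ?sqr_ge0// lerDr sqr_ge0.
Qed.

Lemma csum_cvg u : csummable u ->
  (fun n => complex.Re (psum u n)) @ \oo --> complex.Re (csum u) /\
  (fun n => complex.Im (psum u n)) @ \oo --> complex.Im (csum u).
Proof.
move=> su.
have cR (f : C -> R) : (forall c, `|f c| <= normc c) ->
    cvgn (series (fun k => f (u k))).
  move=> fle; apply: normed_cvg; apply: series_le_cvg su => n //=.
  exact: normc_ge0.
have HR : (fun n => complex.Re (psum u n)) = series (fun k => complex.Re (u k)).
  by apply/funext => n; exact: Re_psum.
have HI : (fun n => complex.Im (psum u n)) = series (fun k => complex.Im (u k)).
  by apply/funext => n; exact: Im_psum.
by rewrite /csum/= HR HI; split; [exact: cR normc_ge_Re|exact: cR normc_ge_Im].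
Qed.

Lemma csum_unique u s :
  (fun n => complex.Re (psum u n)) @ \oo --> complex.Re s ->
  (fun n => complex.Im (psum u n)) @ \oo --> complex.Im s -> csum u = s.
Proof.
by move=> h1 h2; rewrite /csum (cvg_lim _ h1)// (cvg_lim _ h2)//; case: (s).
Qed.

Lemma ReD (a b : C) : complex.Re (a + b) = complex.Re a + complex.Re b.
Proof. by case: a; case: b. Qed.

Lemma ImD (a b : C) : complex.Im (a + b) = complex.Im a + complex.Im b.
Proof. by case: a; case: b. Qed.

Lemma ReM (a b : C) : complex.Re (a * b) =
  complex.Re a * complex.Re b - complex.Im a * complex.Im b.
Proof. by case: a; case: b. Qed.

Lemma ImM (a b : C) : complex.Im (a * b) =
  complex.Re a * complex.Im b + complex.Im a * complex.Re b.
Proof. by case: a; case: b. Qed.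

Lemma csum_lin c u v : csummable u -> csummable v ->
  csum (fun n => c * u n + v n) = c * csum u + csum v.
Proof.
move=> /csum_cvg[u1 u2] /csum_cvg[v1 v2].
have E n : psum (fun n => c * u n + v n) n = c * psum u n + psum v n.
  by rewrite /psum big_split/= mulr_sumr.
apply: csum_unique; under eq_fun do rewrite E.
  under eq_fun do rewrite ReD ReM.
  rewrite ReD ReM.
  by apply: cvgD => //; apply: cvgB; apply: cvgM => //; exact: cvg_cst.
under eq_fun do rewrite ImD ImM.
rewrite ImD ImM.
by apply: cvgD => //; apply: cvgD; apply: cvgM => //; exact: cvg_cst.
Qed.

Lemma csum_recl u : csummable u -> csum u = u 0%N + csum (fun n => u n.+1).
Proof.
move=> /csum_cvg[u1 u2].
suff -> : csum (fun n => u n.+1) = csum u + - u 0%N by ring.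
have E n : psum (fun n => u n.+1) n = psum u n.+1 + - u 0%N.
  by rewrite /psum big_nat_recl// addrC addKr.
apply: csum_unique; under eq_fun do rewrite E.
  under eq_fun do rewrite ReD.
  rewrite ReD; apply: cvgD; last exact: cvg_cst.
  by move: u1; rewrite -(cvg_shiftS (fun n => complex.Re (psum u n))).
under eq_fun do rewrite ImD.
rewrite ImD; apply: cvgD; last exact: cvg_cst.
by move: u2; rewrite -(cvg_shiftS (fun n => complex.Im (psum u n))).
Qed.

Lemma csum_bound u (B : R) : csummable u ->
  (forall n, normc (psum u n) ^+ 2 <= B) -> normc (csum u) ^+ 2 <= B.
Proof.
move=> /csum_cvg[u1 u2] H; rewrite normc_sqE.
have cv : (fun n => complex.Re (psum u n) ^+ 2 + complex.Im (psum u n) ^+ 2) @ \oo -->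
    complex.Re (csum u) ^+ 2 + complex.Im (csum u) ^+ 2.
  by rewrite !expr2; apply: cvgD; under eq_fun do rewrite expr2; apply: cvgM.
rewrite -(cvg_lim _ cv)//; apply: limr_le; first by apply/cvg_ex; eexists; exact: cv.
by apply: nearW => n; rewrite -normc_sqE.
Qed.

(** A weighted Cauchy-Schwarz inequality. Peeling off the first term, it
    follows from (a + r t)^2 <= a^2 / (1 - r) + r t^2. *)
Lemma psum_sq_le (m : C) u n : normc m < 1 ->
  normc (psum (fun k => m ^+ k * u k) n) ^+ 2 <=
  (1 - normc m)^-1 * \sum_(0 <= k < n) normc m ^+ k * normc (u k) ^+ 2.
Proof.
move=> m1; have m0 := normc_ge0 m; have d0 : 0 < 1 - normc m by rewrite subr_gt0.
elim: n u => [|n IH] u.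
  by rewrite /psum !big_geq// normc0 expr0n/= mulr0.
rewrite /psum !big_nat_recl// !expr0 !mul1r.
have -> : \sum_(0 <= i < n) m ^+ i.+1 * u i.+1 =
    m * psum (fun k => m ^+ k * u k.+1) n.
  by rewrite /psum mulr_sumr; apply: eq_bigr => i _; rewrite exprS mulrA.
have -> : \sum_(0 <= i < n) normc m ^+ i.+1 * normc (u i.+1) ^+ 2 =
    normc m * \sum_(0 <= i < n) normc m ^+ i * normc (u i.+1) ^+ 2.
  by rewrite mulr_sumr; apply: eq_bigr => i _; rewrite exprS mulrA.
have := IH (fun k => u k.+1).
have := normc_ge0 (psum (fun k => m ^+ k * u k.+1) n).
have := le_normcD (u 0%N) (m * psum (fun k => m ^+ k * u k.+1) n).
rewrite normcM.
have := normc_ge0 (u 0%N + m * psum (fun k => m ^+ k * u k.+1) n).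
have := normc_ge0 (u 0%N).
set S := \sum_(_ <= _ < _) _.
move: (normc (_ + _)) (normc (psum _ _)) (normc (u 0%N)) (normc m) m0 m1 d0 S.
move=> y t a r r0 r1 d0 S a0 y0 yle t0 IHn.
apply: (@le_trans _ _ ((a + r * t) ^+ 2)).
  by rewrite lerXn2r ?nnegrE// (le_trans y0).
have -> : (1 - r)^-1 * (a ^+ 2 + r * S) =
    (1 - r)^-1 * a ^+ 2 + r * ((1 - r)^-1 * S) by ring.
have h : r * t ^+ 2 <= r * ((1 - r)^-1 * S) by rewrite ler_wpM2l.
apply: (@le_trans _ _ ((1 - r)^-1 * a ^+ 2 + r * t ^+ 2)); last by rewrite lerD2l.
rewrite -subr_ge0.
have -> : (1 - r)^-1 * a ^+ 2 + r * t ^+ 2 - (a + r * t) ^+ 2 =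
  r * (1 - r) * (a / (1 - r) - t) ^+ 2 by field; rewrite gt_eqF.
by apply: mulr_ge0; [apply: mulr_ge0 => //; exact: ltW|exact: sqr_ge0].
Qed.

End ComplexSeries.

(** * Neumann series of measure-preserving maps *)

Section MeasurePreserving.
Context d (T : measurableType d) (R : realType).
Variable mu : {measure set T -> \bar R}.
Local Notation C := R[i].
Implicit Types (f : T -> C) (g h : T -> T).
Local Open Scope ereal_scope.

Definition preserving g :=
  measurable_fun setT g /\ forall A, measurable A -> mu (g @^-1` A) = mu A.

Lemma preserving_comp g h : preserving g -> preserving h -> preserving (g \o h).
Proof.
move=> [mg Hg] [mh Hh]; split; first exact: measurableT_comp.
move=> A mA; rewrite comp_preimage Hh ?Hg// -[_ @^-1` _]setTI; exact: mg.
Qed.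

Lemma preserving_iter g n : preserving g -> preserving (iter n g).
Proof.
move=> pg; elim: n => [|n IH]; first by split=> //; exact: measurable_id.
exact: preserving_comp.
Qed.

Lemma preserving_integral g (F : T -> \bar R) : preserving g ->
  measurable_fun setT F -> (forall x, 0 <= F x) ->
  \int[mu]_x F (g x) = \int[mu]_x F x.
Proof.
move=> [mg Hg] mF F0.
have -> : \int[mu]_x F x = \int[pushforward mu g]_x F x.
  by apply: eq_measure_integral => A mA _; rewrite -Hg.
by rewrite ge0_integral_pushforward// preimage_setT.
Qed.

Lemma preserving_ae g (P : T -> Prop) : preserving g ->
  (\forall x \ae mu, P x) -> \forall x \ae mu, P (g x).
Proof.
move=> [mg Hg] [N [mN N0 PN]]; exists (g @^-1` N); split.
- by rewrite -[_ @^-1` _]setTI; exact: mg.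
- by rewrite Hg.
- by move=> x /= nP; apply: PN.
Qed.

Lemma cmeasurable_comp g f : preserving g -> cmeasurable f -> cmeasurable (f \o g).
Proof.
move=> [mg _] [fr fi]; split.
  exact: (measurableT_comp fr mg).
exact: (measurableT_comp fi mg).
Qed.

Lemma energy_comp g f : preserving g -> cmeasurable f ->
  energy mu (f \o g) = energy mu f.
Proof.
move=> pg mf; rewrite /energy -(preserving_integral pg (measurable_sqnorm mf))//.
exact: sqnorm_ge0.
Qed.

Lemma L2_comp g f : preserving g -> L2 mu f -> L2 mu (f \o g).
Proof.
move=> pg /L2P[mf fi]; apply/L2P; split; first exact: cmeasurable_comp.
by rewrite energy_comp.
Qed.

Lemma bounded_koopman g : preserving g -> bounded_operator mu (fun f => f \o g).
Proof.
move=> pg; apply: (@bounded_operatorI _ _ _ _ _ 1%R) => //.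
- by move=> f /(L2_comp pg)/L2P[].
- by move=> c f h _ _; exact: nearW.
- by move=> f /L2P[mf _]; rewrite mul1e energy_comp.
Qed.

Section Neumann.
Variables (g : T -> T) (m : C).
Hypothesis pg : preserving g.
Hypothesis m1 : (normc m < 1)%R.
Let r := normc m.
Let r0 : (0 <= r)%R. Proof. exact: normc_ge0. Qed.
Let d0 : (0 < 1 - r)%R. Proof. by rewrite subr_gt0. Qed.

(** Its integral is finite, so that it is finite almost everywhere, and it
    dominates the squared modulus of the Neumann series along the orbit of x
    by [psum_sq_le]. *)
Definition orbit_energy f x : \bar R :=
  \sum_(0 <= n <oo) (r ^+ n)%:E * sqnorm (f \o iter n g) x.

(** The Neumann series of (1 - m U)^-1 for the composition operator U f = f o
    g. The value 0 where [orbit_energy] is infinite makes the function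
    measurable everywhere. *)
Definition neumann f x : C :=
  if orbit_energy f x < +oo then csum (fun n => m ^+ n * f (iter n g x))%R else 0%R.

Let term0 f n x : 0 <= (r ^+ n)%:E * sqnorm (f \o iter n g) x.
Proof. by rewrite mule_ge0 ?sqnorm_ge0// lee_fin exprn_ge0. Qed.

Let mterm f n : cmeasurable f ->
  measurable_fun setT (fun x => (r ^+ n)%:E * sqnorm (f \o iter n g) x).
Proof.
move=> mf; apply: measurable_funeM; apply: measurable_sqnorm.
exact: cmeasurable_comp (preserving_iter n pg) mf.
Qed.

Let morbit f : cmeasurable f -> measurable_fun setT (orbit_energy f).
Proof.
by move=> mf; apply: ge0_emeasurable_sum => // n _; exact: mterm.
Qed.

Let orbit_ge0 f x : 0 <= orbit_energy f x.
Proof. by apply: nneseries_ge0 => n _ _; exact: term0. Qed.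

Let geometric_le n : (\sum_(0 <= k < n) r ^+ k <= (1 - r)^-1)%R.
Proof.
rewrite -[leRHS]mulr1 ler_pdivlMl// .
elim: n => [|n IH]; first by rewrite big_geq// mulr0.
rewrite big_nat_recl// expr0.
under eq_bigr do rewrite exprS.
rewrite -mulr_sumr; move: (\sum_(_ <= _ < _) _)%R IH => S IH.
have : (r * ((1 - r) * S) <= r)%R by rewrite ler_piMr.
lra.
Qed.

Lemma orbit_energy_integral f : cmeasurable f ->
  \int[mu]_x orbit_energy f x <= (1 - r)^-1%:E * energy mu f.
Proof.
move=> mf; rewrite integral_nneseries//; last by move=> n; exact: mterm.
apply: lime_le.
  by apply: is_cvg_nneseries => n _ _; apply: integral_ge0.
apply: nearW => n.
under eq_bigr => k _.
  rewrite ge0_integralZl//; last 3 first.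
  - by apply: measurable_sqnorm; exact: cmeasurable_comp (preserving_iter k pg) mf.
  - by move=> x _; exact: sqnorm_ge0.
  - by rewrite lee_fin exprn_ge0.
  rewrite -/(energy mu _) (energy_comp (preserving_iter k pg) mf).
  over.
rewrite -ge0_sume_distrl//; last by move=> i _; rewrite lee_fin exprn_ge0.
by rewrite lee_wpmul2r ?energy_ge0// sumEFin lee_fin geometric_le.
Qed.

Lemma orbit_energy_ae f : L2 mu f -> \forall x \ae mu, orbit_energy f x < +oo.
Proof.
move=> /L2P[mf fi].
have If : mu.-integrable setT (orbit_energy f).
  apply/integrableP; split; first exact: morbit.
  under eq_integral => x _ do rewrite gee0_abs//.
  apply: le_lt_trans (orbit_energy_integral mf) _.
  by rewrite lte_mul_pinfty// lee_fin invr_ge0 ltW.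
have := integrable_ae measurableT If.
by apply: filterS => x /= /(_ I); rewrite ge0_fin_numE.
Qed.

Let partial_fin f x n : orbit_energy f x < +oo ->
  (\sum_(0 <= k < n) r ^+ k * normc (f (iter k g x)) ^+ 2 <= fine (orbit_energy f x))%R.
Proof.
move=> fx; rewrite -lee_fin fineK ?ge0_fin_numE// -sumEFin.
by apply: le_trans (nneseries_lim_ge n _) => // k _ _.
Qed.

Lemma orbit_csummable f x : orbit_energy f x < +oo ->
  csummable (fun n => m ^+ n * f (iter n g x))%R.
Proof.
move=> fx; apply: nondecreasing_is_cvgn.
  by apply/nondecreasing_series => n _ _; exact: normc_ge0.
exists ((1 - r)^-1 + fine (orbit_energy f x))%R => _ [n _ <-] /=.
apply: (@le_trans _ _
  (\sum_(0 <= k < n) (r ^+ k + r ^+ k * normc (f (iter k g x)) ^+ 2))%R).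
  apply: ler_sum => k _; rewrite normcM normcX -/r.
  rewrite -[X in (_ <= X + _)%R]mulr1 -mulrDr ler_wpM2l ?exprn_ge0//.
  by have := normc_ge0 (f (iter k g x)); nra.
by rewrite big_split/= lerD ?geometric_le ?partial_fin.
Qed.

Lemma neumann_measurable f : cmeasurable f -> cmeasurable (neumann f).
Proof.
move=> mf.
have mb : measurable_fun setT (fun x => orbit_energy f x < +oo).
  by apply: measurable_fun_lte; [exact: morbit|exact: measurable_cst].
have mp n : cmeasurable (fun x => psum (fun n => m ^+ n * f (iter n g x))%R n).
  elim: n => [|n IH].
    rewrite (_ : (fun x => _) = fun=> 0%R); first by split; exact: measurable_cst.
    by apply/funext => x; rewrite /psum big_geq.
  rewrite (_ : (fun x => _) = (fun x => m ^+ n * (f \o iter n g) x +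
      psum (fun n => m ^+ n * f (iter n g x)) n)%R).
    by apply: cmeasurable_lin => //; exact: cmeasurable_comp (preserving_iter n pg) mf.
  by apply/funext => x; rewrite psumS addrC.
split.
  apply: (@measurable_fun_cvg _ _ _ _ (fun n x => if orbit_energy f x < +oo then
      complex.Re (psum (fun n => m ^+ n * f (iter n g x))%R n) else 0%R)).
    by move=> n; apply: measurable_fun_ifT => //; case: (mp n).
  move=> x _; rewrite /neumann; case: ifPn => [fx|_]; last exact: cvg_cst.
  by have [] := csum_cvg (orbit_csummable fx).
apply: (@measurable_fun_cvg _ _ _ _ (fun n x => if orbit_energy f x < +oo then
    complex.Im (psum (fun n => m ^+ n * f (iter n g x))%R n) else 0%R)).
  by move=> n; apply: measurable_fun_ifT => //; case: (mp n).
move=> x _; rewrite /neumann; case: ifPn => [fx|_]; last exact: cvg_cst.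
by have [] := csum_cvg (orbit_csummable fx).
Qed.

Lemma neumann_sqnorm f x : sqnorm (neumann f) x <= (1 - r)^-1%:E * orbit_energy f x.
Proof.
rewrite /sqnorm /neumann; case: ifPn => [fx|_]; last first.
  by rewrite normc0 expr0n/= mule_ge0// lee_fin invr_ge0 ltW.
rewrite -[orbit_energy f x]fineK ?ge0_fin_numE// -EFinM lee_fin.
apply: csum_bound; first exact: orbit_csummable.
move=> n; apply: le_trans (psum_sq_le _ n m1) _.
by rewrite ler_wpM2l ?invr_ge0 ?(ltW d0)// partial_fin.
Qed.

Lemma bounded_neumann : bounded_operator mu neumann.
Proof.
apply: (@bounded_operatorI _ _ _ _ _ ((1 - r)^-1 * (1 - r)^-1)%R).
- by rewrite mulr_ge0// invr_ge0 ltW.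
- by move=> f /L2P[mf _]; exact: neumann_measurable.
- move=> c f h fL hL.
  have H1 := orbit_energy_ae fL; have H2 := orbit_energy_ae hL.
  have H3 := orbit_energy_ae (L2_lin c fL hL).
  apply: filterS3 H1 H2 H3 => x Hf Hh Hfh.
  rewrite /neumann Hf Hh Hfh -csum_lin; [|exact: orbit_csummable..].
  by congr csum; apply/funext => n; ring.
- move=> f /L2P[mf fi].
  apply: (@le_trans _ _ (\int[mu]_x ((1 - r)^-1%:E * orbit_energy f x))).
    apply: ge0_le_integral => //.
    + by move=> x _; exact: sqnorm_ge0.
    + by apply: measurable_sqnorm; exact: neumann_measurable.
    + by apply: measurable_funeM; exact: morbit.
    + by move=> x _; exact: neumann_sqnorm.
  rewrite ge0_integralZl//; last 2 first.
  - exact: morbit.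
  - by rewrite lee_fin invr_ge0 ltW.
  by rewrite EFinM -muleA lee_wpmul2l ?orbit_energy_integral// lee_fin invr_ge0 ltW.
Qed.

Lemma neumann_comp f x : neumann (f \o g) x = neumann f (g x).
Proof.
have E n : (f \o g) (iter n g x) = f (iter n g (g x)) by rewrite /= -iterSr.
rewrite /neumann; have -> : orbit_energy (f \o g) x = orbit_energy f (g x).
  by rewrite /orbit_energy /sqnorm; apply: eq_eseriesr => n _ /=; rewrite -iterS iterSr.
by case: ifP => // _; congr csum; apply/funext => n; rewrite E.
Qed.

Lemma neumann_step f : L2 mu f ->
  \forall x \ae mu, neumann f x = (f x + m * neumann f (g x))%R.
Proof.
move=> fL; have H1 := orbit_energy_ae fL; have H2 := preserving_ae pg H1.
apply: filterS2 H1 H2 => x Hx Hgx; rewrite /neumann Hx Hgx.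
rewrite (csum_recl (orbit_csummable Hx)) expr0 mul1r/=; congr (_ + _)%R.
have z : csummable (fun=> 0%R : C).
  rewrite /csummable (_ : series _ = fun=> 0%R); first exact: is_cvg_cst.
  by apply/funext => n; rewrite /series/= big1// => i _; exact: normc0.
have := csum_lin m (orbit_csummable Hgx) z.
have -> : csum (fun=> 0%R : C) = 0%R.
  by apply: csum_unique; rewrite /psum; under eq_fun do rewrite big1//; exact: cvg_cst.
rewrite addr0 => <-; congr csum; apply/funext => n.
by rewrite addr0 mulrA -exprS -iterS iterSr.
Qed.

Definition one_sub (f : T -> C) x : C := (- m * f (g x) + f x)%R.

Lemma bounded_one_sub : bounded_operator mu one_sub.
Proof. exact: bounded_lin (bounded_koopman pg) (bounded_id mu). Qed.

Lemma neumann_right f : L2 mu f -> \forall x \ae mu, one_sub (neumann f) x = f x.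
Proof.
by move=> fL; apply: filterS (neumann_step fL) => x E; rewrite /one_sub E; ring.
Qed.

Lemma neumann_left f : L2 mu f -> \forall x \ae mu, neumann (one_sub f) x = f x.
Proof.
move=> fL.
have H1 := operator_lin (- m)%R bounded_neumann (L2_comp pg fL) fL.
apply: filterS2 H1 (neumann_step fL) => x.
rewrite neumann_comp => E1 E2.
have -> : neumann (one_sub f) x = (- m * neumann f (g x) + neumann f x)%R := E1.
by rewrite E2; ring.
Qed.

End Neumann.
End MeasurePreserving.

(** * The dihedral action on the boundary and the resolvent *)

Section BoundaryAction.
Variable R : realType.
Variable mu : probability boundary R.
Hypothesis mu_bernoulli : uniform_bernoulli mu.
Local Open Scope ereal_scope.

Lemma measurable_cylinder (u : seq bool) : measurable (cylinder u : set boundary).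
Proof. by apply: sub_sigma_algebra; exists u. Qed.

Lemma cylinder_nil : cylinder [::] = setT.
Proof. by apply/seteqP; split. Qed.

Lemma cylinder_cons b u x : cylinder (b :: u) x <-> x 0%N = b /\ cylinder u (bshift x).
Proof.
split=> [H|[H0 H] [|i]//]; last exact: H.
by split; [exact: (H 0%N)|move=> i iu; exact: (H i.+1)].
Qed.

Lemma cylinder_disjoint u v : (size u <= size v)%N ->
  (cylinder u `&` cylinder v = cylinder v) \/ (cylinder u `&` cylinder v = set0).
Proof.
move=> uv; have [[x [xu xv]]|H] := pselect (exists x, cylinder u x /\ cylinder v x).
  left; apply/seteqP; split=> [y []//|y yv]; split=> // i iu.
  by rewrite yv ?(leq_trans iu)// -(xv i) ?(leq_trans iu)// xu.
by right; apply/seteqP; split=> // y [yu yv]; apply: H; exists y.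
Qed.

(** Stated on inverse images, which are what the image of a measure depends
    on; every automorphism of the rooted tree has this property. *)
Definition automorphism (g : (nat -> bool) -> nat -> bool) :=
  forall u, exists u', size u' = size u /\ g @^-1` cylinder u = cylinder u'.

(** The cylinders and the empty set form a pi-system that generates the sigma-
    algebra, and a Bernoulli measure gives the same mass to all cylinders of
    one level. *)
Lemma automorphism_preserving (g : boundary -> boundary) :
  automorphism g -> preserving mu g.
Proof.
move=> ag.
have mg : measurable_fun setT g.
  apply: (measurability (range cylinder : set (set boundary))) => // _ [_ [u _ <-] <-].
  by rewrite setTI; have [u' [_ ->]] := ag u; exact: measurable_cylinder.
split=> // A mA.
(* the empty set is added because disjoint cylinders must intersect in G *)
pose G : set (set boundary) := range cylinder `|` [set set0].
have GE : @measurable _ boundary = <<s G >>.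
  apply/seteqP; split.
    by apply: sub_sigma_algebra2 => X XG; left.
  apply: smallest_sub; first exact: smallest_sigma_algebra.
  move=> X [[u _ <-]| ->]; [exact: measurable_cylinder|exact: measurable0].
have IG : setI_closed G.
  move=> X Y [[u _ <-]| ->] [[v _ <-]| ->]; rewrite ?set0I ?setI0; try by right.
  have [uv|/ltnW uv] := leqP (size u) (size v).
    by have [->| ->] := cylinder_disjoint uv; [left; exists v|right].
  by rewrite setIC; have [->| ->] := cylinder_disjoint uv; [left; exists u|right].
apply: (@measure_unique _ _ _ G (fun=> setT) GE IG _ _ (pushforward mu g) mu) => //.
- by move=> _; left; exists [::] => //; exact: cylinder_nil.
- by rewrite bigcup_const.
- move=> X [[u _ <-]| ->]; last by rewrite !measure0.
  have [u' [su uE]] := ag u.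
  transitivity (mu (cylinder u')); first exact: (congr1 mu uE).
  apply: etrans (mu_bernoulli u') _; rewrite su; exact/esym/mu_bernoulli.
- move=> _; suff : mu setT < +oo by exact.
  by rewrite probability_setT ltry.
Qed.

Lemma automorphism_a : automorphism act_a.
Proof.
move=> [|b u]; first by exists [::]; rewrite cylinder_nil preimage_setT.
exists (~~ b :: u); split=> //; apply/seteqP; split=> x /=.
  by move/cylinder_cons => [/= <-]; rewrite negbK => H; apply/cylinder_cons.
by move/cylinder_cons => [/= x0 H]; apply/cylinder_cons; split=> //=; rewrite x0 negbK.
Qed.

Lemma automorphism_t : automorphism act_t.
Proof.
elim=> [|b u [u' [su uE]]]; first by exists [::]; rewrite cylinder_nil preimage_setT.
case: b.
  exists (true :: u'); split; first by rewrite /= su.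
  rewrite eqEsubset; split=> x /=.
    rewrite -(bconsE x); case: (x 0%N);
      rewrite ?act_t0 ?act_t1 => /cylinder_cons[//= _ H].
    by apply/cylinder_cons; split=> //; rewrite -uE.
  move=> /cylinder_cons[x0]; rewrite -uE => H.
  by rewrite -(bconsE x) x0 act_t1; apply/cylinder_cons.
have [v [sv vE]] := automorphism_a u.
exists (false :: v); split; first by rewrite /= sv.
rewrite eqEsubset; split=> x /=.
  rewrite -(bconsE x); case: (x 0%N);
    rewrite ?act_t0 ?act_t1 => /cylinder_cons[//= _ H].
  by apply/cylinder_cons; split=> //; rewrite -vE.
move=> /cylinder_cons[x0]; rewrite -vE => H.
by rewrite -(bconsE x) x0 act_t0; apply/cylinder_cons.
Qed.

Lemma preserving_a : preserving mu (act_a : boundary -> boundary).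
Proof. exact: automorphism_preserving automorphism_a. Qed.

Lemma preserving_t : preserving mu (act_t : boundary -> boundary).
Proof. exact: automorphism_preserving automorphism_t. Qed.

Lemma koopman_aE (f : boundary -> R[i]) : koopman Dinf_a f = f \o act_a.
Proof. by []. Qed.

Lemma koopman_tE (f : boundary -> R[i]) : koopman Dinf_t f = f \o act_t.
Proof. by []. Qed.

Lemma bounded_A_pi (z : 'rV[R[i]]_3) : bounded_operator mu (A_pi z).
Proof.
have b1 := bounded_scale (z 0%R 2%R) (bounded_koopman preserving_t).
have b2 := bounded_lin (z 0%R 1%R) (bounded_koopman preserving_a) b1.
have b3 := bounded_lin (z 0%R 0%R) (bounded_id mu) b2.
rewrite (_ : A_pi z = (fun f x =>
  z 0 0 * f x + (z 0 1 * f (act_a x) + z 0 2 * f (act_t x)))%R) //.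
by apply/funext => f; apply/funext => x; rewrite /A_pi koopman_aE koopman_tE /= addrA.
Qed.

Let rot : boundary -> boundary := act_a \o act_t.
Let tor : boundary -> boundary := act_t \o act_a.

(** Let U be composition with [rot]. As a and t are involutions, A_z A_z' = Q
    - z1 z2 (U + U^-1), which the relations [joukowski z m k] factor as k (1 -
    m U) (1 - m U^-1). *)
Lemma A_pi_factor (z : 'rV[R[i]]_3) m k (f : boundary -> R[i]) : joukowski z m k ->
  let z' := vec3 (z 0 0)%R (- z 0 1)%R (- z 0 2)%R in
  A_pi z (A_pi z' f) = (fun x => k * one_sub rot m (one_sub tor m f) x)%R /\
  A_pi z' (A_pi z f) = (fun x => k * one_sub rot m (one_sub tor m f) x)%R.
Proof.
rewrite /joukowski /A_pi !koopman_aE !koopman_tE /= !vec3_0 !vec3_1 !vec3_2.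
move: (z 0%R 0%R) (z 0%R 1%R) (z 0%R 2%R) => a b c [h1 h2].
have H x : ((a ^+ 2 - b ^+ 2 - c ^+ 2) * f x -
    (b * c) * (f (act_t (act_a x)) + f (act_a (act_t x))) =
    k * (- m * (- m * f x + f (act_a (act_t x))) +
         (- m * f (act_t (act_a x)) + f x)))%R.
  by rewrite h1 h2; ring.
split; apply/funext => x; rewrite /one_sub /rot /tor /= !act_aK !act_tK ?act_aK.
  by rewrite -H; ring.
by rewrite -H; ring.
Qed.

(** For |m| < 1 both factors in [A_pi_factor] are inverted by Neumann series,
    since U and U^-1 preserve the norm. *)
Lemma invertible_off_conics (z : 'rV[R[i]]_3) :
  ~ on_spectral_conic z -> invertible_operator mu (A_pi z).
Proof.
move=> nS; have [m [k [jz m1 k0]]] := joukowski_lt1 nS.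
have pg : preserving mu rot by exact: preserving_comp preserving_a preserving_t.
have ph : preserving mu tor by exact: preserving_comp preserving_t preserving_a.
pose A' := A_pi (vec3 (z 0 0)%R (- z 0 1)%R (- z 0 2)%R).
have bA' : bounded_operator mu A' by exact: bounded_A_pi.
have bN := bounded_comp (bounded_neumann ph m1) (bounded_neumann pg m1).
pose N f x := (k^-1 * (neumann tor m \o neumann rot m) f x)%R.
have bN' : bounded_operator mu N by exact: bounded_scale.
apply: (invertible_of_sides (bounded_A_pi z) (bounded_comp bN' bA')
  (bounded_comp bA' bN')).
- move=> f fL; rewrite [(N \o A') _]/(N (A' _)) /A' (A_pi_factor f jz).2.
  have h1 := neumann_left ph m1 fL.
  have oL := operator_L2 (bounded_one_sub m ph) fL.
  have h2 := neumann_left pg m1 oL.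
  have ooL := operator_L2 (bounded_one_sub m pg) oL.
  have nL := operator_L2 (bounded_neumann pg m1) ooL.
  have h3 := operator_ae (bounded_neumann ph m1) nL oL h2.
  have h4 := operator_lin k bN ooL (L2_0 mu).
  have h5 : \forall x \ae mu, (neumann tor m \o neumann rot m) (fun=> 0%R) x = 0%R.
    have := operator_lin (-1)%R bN (L2_0 mu) (L2_0 mu).
    apply: filterS => x.
    rewrite (_ : (fun=> _) = fun=> 0%R); last by apply/funext => y; rewrite mulr0 addr0.
    by move=> ->; rewrite mulN1r addNr.
  apply: filterS2 (filterI h1 h3) (filterI h4 h5) => x [E1 E3] [E4 E5].
  rewrite /N.
  have -> : (fun x => k * one_sub rot m (one_sub tor m f) x)%R =
     (fun x => k * one_sub rot m (one_sub tor m f) x + 0)%R.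
    by apply/funext => y; rewrite addr0.
  by rewrite E4 E5 addr0 mulrA mulVf// mul1r /= E3 E1.
- move=> f fL; rewrite [(A' \o N) _]/(A' (N _)) /A' (A_pi_factor _ jz).1.
  have NL := operator_L2 (bounded_neumann pg m1) fL.
  have NNL := operator_L2 bN fL.
  have h1 := neumann_right pg m1 fL.
  have h2 := neumann_right ph m1 NL.
  have oNN := operator_L2 (bounded_one_sub m ph) NNL.
  have h3 := operator_ae (bounded_one_sub m pg) oNN NL h2.
  apply: filterS2 h1 h3 => x E1 E3.
  have kE : (k * one_sub rot m (one_sub tor m (N f)) x =
      one_sub rot m (one_sub tor m ((neumann tor m \o neumann rot m) f)) x)%R.
    have H a b c d : (k * (- m * (- m * (k^-1 * a) + k^-1 * b) +
        (- m * (k^-1 * c) + k^-1 * d)) =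
        - m * (- m * a + b) + (- m * c + d))%R by field.
    exact: H.
  by rewrite kE E3 E1.
Qed.

End BoundaryAction.

(** * Approximate eigenfunctions on the spectral conics *)

Section ComplexMeasurability.
Context d (T : measurableType d) (R : realType).
Implicit Types f : T -> R[i].

Lemma cmeasurable_cst (c : R[i]) : cmeasurable (fun _ : T => c).
Proof. by split; exact: measurable_cst. Qed.

Lemma cmeasurable_conj f : cmeasurable f -> cmeasurable (fun x => ((f x)^*)%C).
Proof.
move=> [fr fi]; split.
  rewrite (_ : (fun x => _) = fun x => complex.Re (f x)) //.
  by apply/funext => x; case: (f x).
rewrite (_ : (fun x => _) = \- (fun x => complex.Im (f x))).
  exact: measurableT_comp.
by apply/funext => x /=; case: (f x).
Qed.

Lemma cmeasurable_scale (c : R[i]) f : cmeasurable f -> cmeasurable (fun x => c * f x).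
Proof.
move=> mf; rewrite (_ : (fun x => _) = (fun x => c * f x + 0)).
  by apply: cmeasurable_lin => //; exact: cmeasurable_cst.
by apply/funext => x; rewrite addr0.
Qed.

Lemma cmeasurable_sq f : cmeasurable f -> cmeasurable (fun x => f x ^+ 2).
Proof.
move=> [fr fi]; split.
  under eq_fun do rewrite expr2 ReM.
  by apply: measurable_funB; apply: measurable_funM.
under eq_fun do rewrite expr2 ImM.
by apply: measurable_funD; apply: measurable_funM.
Qed.

End ComplexMeasurability.

Section Characters.
Variable R : realType.
Variable mu : probability boundary R.
Hypothesis mu_bernoulli : uniform_bernoulli mu.
Local Notation C := R[i].
Implicit Types (w c : C) (x : boundary).

Let conj1 : ((1 : C)^*)%C = 1. Proof. exact: (conjc1 R). Qed.

Let muT : mu [set: boundary] = 1%E. Proof. exact: probability_setT. Qed.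

(** For w^(2^n) = 1 this is w^c(x), where c(x) in Z / 2^n is the code of the
    first n letters of x for which a acts as c -> 1 - c and t as c -> -c. The
    recursion follows the one defining the action. *)
Fixpoint chi n w (x : nat -> bool) : C :=
  if n is n'.+1 then
    let c := chi n' (w ^+ 2) (bshift x) in if x 0%N then c else w * (c^*)%C
  else 1.

Lemma normc_sq_conj c : normc c = 1 -> c * (c^*)%C = 1.
Proof.
by move=> c1; rewrite -[c * _]normCK -normcE c1 (rmorph1 (real_complex R)) expr1n.
Qed.

Lemma chi0 w x : chi 0 w x = 1. Proof. by []. Qed.

Lemma chi_true n w s : chi n.+1 w (bcons true s) = chi n (w ^+ 2) s.
Proof. by []. Qed.

Lemma chi_false n w s :
  chi n.+1 w (bcons false s) = w * ((chi n (w ^+ 2) s)^*)%C.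
Proof. by []. Qed.

Lemma normc_chi n w x : normc w = 1 -> normc (chi n w x) = 1.
Proof.
elim: n w x => [|n IH] w x w1 /=; first exact: normc1.
have w21 : normc (w ^+ 2) = 1 by rewrite normcX w1 expr1n.
by case: (x 0%N); rewrite ?normcM ?normc_conj ?w1 ?mul1r IH.
Qed.

Lemma conjcM (a b : C) : ((a * b)^*)%C = (a^*)%C * (b^*)%C.
Proof. exact: rmorphM. Qed.

Lemma chi_a n w x : normc w = 1 -> w ^+ (2 ^ n) = 1 ->
  chi n w (act_a x) = w * ((chi n w x)^*)%C.
Proof.
case: n => [|n] w1 wn; first by rewrite !chi0 conj1 mulr1 -[w]expr1 wn.
rewrite /= (_ : bshift (act_a x) = bshift x) //.
case: (x 0%N) => //=.
by rewrite conjcM conjcK mulrA normc_sq_conj// mul1r.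
Qed.

Lemma chi_t n w x : normc w = 1 -> w ^+ (2 ^ n) = 1 ->
  chi n w (act_t x) = ((chi n w x)^*)%C.
Proof.
elim: n w x => [|n IH] w x w1 wn; first by rewrite !chi0 conj1.
have w21 : normc (w ^+ 2) = 1 by rewrite normcX w1 expr1n.
have wn2 : (w ^+ 2) ^+ (2 ^ n) = 1 by rewrite -exprM -expnS.
rewrite -(bconsE x); case: (x 0%N).
  by rewrite act_t1 !chi_true IH.
rewrite act_t0 !chi_false chi_a// !conjcM !conjcK !mulrA.
by rewrite normc_sq_conj// mul1r.
Qed.

Lemma measurable_shift : measurable_fun setT (bshift : boundary -> boundary).
Proof.
apply: (measurability (range cylinder : set (set boundary))) => // _ [_ [u _ <-] <-].
rewrite setTI.
have -> : (bshift : boundary -> boundary) @^-1` cylinder u =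
    cylinder (true :: u) `|` cylinder (false :: u).
  rewrite eqEsubset; split=> x /=.
    by move=> H; case E : (x 0%N); [left|right]; apply/cylinder_cons.
  by move=> [] /cylinder_cons[].
by apply: measurableU; exact: measurable_cylinder.
Qed.

Lemma measurable_letter : measurable_fun setT (fun x : boundary => x 0%N).
Proof.
apply: (measurable_fun_bool true); rewrite setTI.
have -> : (fun x : boundary => x 0%N) @^-1` [set true] = cylinder [:: true].
  rewrite eqEsubset; split=> x /=.
    by move=> x0; apply/cylinder_cons; rewrite cylinder_nil.
  by move=> /cylinder_cons[].
exact: measurable_cylinder.
Qed.




Lemma cmeasurable_chi n w : cmeasurable (chi n w : boundary -> C).
Proof.
elim: n w => [|n IH] w; first exact: cmeasurable_cst.
have [sr si] := IH (w ^+ 2).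
have ms : cmeasurable (fun x : boundary => chi n (w ^+ 2) (bshift x)).
  split; first exact: (measurableT_comp sr measurable_shift).
  exact: (measurableT_comp si measurable_shift).
have [cr ci] := cmeasurable_scale w (cmeasurable_conj ms).
case: ms => mr mi; split.
  rewrite (_ : (fun x => _) = (fun x : boundary =>
      if x 0%N then complex.Re (chi n (w ^+ 2) (bshift x))
      else complex.Re (w * ((chi n (w ^+ 2) (bshift x))^*)%C))).
    exact: measurable_fun_ifT measurable_letter mr cr.
  by apply/funext => x /=; case: (x 0%N).
rewrite (_ : (fun x => _) = (fun x : boundary =>
    if x 0%N then complex.Im (chi n (w ^+ 2) (bshift x))
    else complex.Im (w * ((chi n (w ^+ 2) (bshift x))^*)%C))).
  exact: measurable_fun_ifT measurable_letter mi ci.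
by apply/funext => x /=; case: (x 0%N).
Qed.

Local Open Scope ereal_scope.

Section Orthogonality.
Variables (n : nat) (w : C).
Hypothesis w1 : (normc w = 1)%R.
Hypothesis wn : (w ^+ (2 ^ n) = 1)%R.
Hypothesis w2 : (w ^+ 2 != 1)%R.

Let u c (x : boundary) : R := complex.Re (c * chi n w x ^+ 2)%R.

Let mu_u c : measurable_fun setT (u c).
Proof. by have [] := cmeasurable_scale c (cmeasurable_sq (cmeasurable_chi n w)). Qed.

Let int_u c : mu.-integrable setT (EFin \o u c).
Proof.
apply: measurable_bounded_integrable => //.
  by suff : mu setT < +oo by []; rewrite muT ltry.
exists (normc c); split; first by rewrite num_real.
move=> M cM x _ /=; apply: le_trans (normc_ge_Re _) _.
by rewrite normcM normcX normc_chi// expr1n mulr1 ltW.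
Qed.

Let rotate c x : u c (act_t (act_a x)) = u (c * (w^*)%C ^+ 2)%R x.
Proof.
by rewrite /u chi_t// chi_a// conjcM conjcK exprMn mulrA.
Qed.

(** The measure is invariant under the composition of a and t, which
    multiplies [chi] by the conjugate of w. With I(e) for the integral of the
    real part of e chi^2, and v for the square of the conjugate of w, this
    gives I(e) = I(e v) for all e, hence I(e (1 - v)) = 0 by additivity; and 1
    - v is invertible. *)
Lemma integral_chi_sq c : \int[mu]_x (complex.Re (c * chi n w x ^+ 2)%R)%:E = 0.
Proof.
have pg := preserving_comp (preserving_t mu_bernoulli) (preserving_a mu_bernoulli).
have inv e : \int[mu]_x (u (e * (w^*)%C ^+ 2)%R x)%:E = \int[mu]_x (u e x)%:E.
  have [mg Hg] := pg.
  have -> : \int[mu]_x (u e x)%:E =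
      \int[pushforward mu (act_t \o act_a : boundary -> boundary)]_x (u e x)%:E.
    by apply: eq_measure_integral => A mA _; rewrite -Hg.
  rewrite integral_pushforward//; last 2 first.
  - by apply/measurable_EFinP; exact: mu_u.
  - rewrite preimage_setT (_ : _ \o _ = EFin \o u (e * (w^*)%C ^+ 2)%R).
      exact: int_u.
    by apply/funext => x /=; rewrite rotate.
  by rewrite preimage_setT; apply: eq_integral => x _ /=; rewrite rotate.
have w2' : (1 - (w^*)%C ^+ 2 != 0)%R.
  rewrite subr_eq0; apply: contraNneq w2 => E.
  have := normc_sq_conj w1 => /(congr1 (fun z => z ^+ 2))%R.
  by rewrite exprMn -E mulr1 expr1n => ->.
pose e := (c / (1 - (w^*)%C ^+ 2))%R.
have -> : \int[mu]_x (complex.Re (c * chi n w x ^+ 2)%R)%:E =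
    \int[mu]_x ((u e x)%:E - (u (e * (w^*)%C ^+ 2)%R x)%:E).
  apply: eq_integral => x _; rewrite -EFinB; congr EFin.
  rewrite /u -raddfB/=; congr complex.Re.
  by rewrite -mulrBl -{1}[e]mulr1 -mulrBr /e divfK.
rewrite integralB_EFin// inv subee//.
exact: (integrable_fin_num measurableT (int_u e)).
Qed.

(** [chi] and its conjugate are orthonormal: the cross term is an integral as
    in [integral_chi_sq]. *)
Lemma energy_chi_comb (a b : C) :
  energy mu (fun x => a * chi n w x + b * ((chi n w x)^*)%C)%R =
  (normc a ^+ 2 + normc b ^+ 2)%:E.
Proof.
pose e : C := (a * (b^*)%C + a * (b^*)%C)%R.
have E x : sqnorm (fun x => a * chi n w x + b * ((chi n w x)^*)%C)%R x =
    (normc a ^+ 2 + normc b ^+ 2)%:E + (u e x)%:E.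
  rewrite /sqnorm -EFinD; congr EFin.
  have := normc_chi n x w1; rewrite /u /e; move: (chi n w x) => [p q].
  move=> /(congr1 (fun z => z ^+ 2))%R; rewrite normc_sqE/= expr1n => pq.
  rewrite -[(normc a ^+ 2 + _)%R]mulr1 -pq !normc_sqE.
  by case: (a) => a1 a2; case: (b) => b1 b2 /=; ring.
rewrite /energy; under eq_integral do rewrite E.
have Ic : mu.-integrable setT (fun=> (normc a ^+ 2 + normc b ^+ 2)%:E).
  exact: finite_measure_integrable_cst.
rewrite integralD//; last exact: int_u.
by rewrite [X in _ + X]integral_chi_sq adde0 integral_cst// [X in _ * X]muT mule1.
Qed.

End Orthogonality.

Lemma A_pi_chi n w (z : 'rV[C]_3) (a b : C) x :
  (normc w = 1)%R -> (w ^+ (2 ^ n) = 1)%R ->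
  A_pi z (fun x : boundary => a * chi n w x + b * ((chi n w x)^*)%C)%R x =
  ((z 0 0 * a + (z 0 1 * (w^*)%C + z 0 2) * b) * chi n w x +
   (z 0 0 * b + (z 0 1 * w + z 0 2) * a) * ((chi n w x)^*)%C)%R.
Proof.
move=> w1 wn; rewrite /A_pi koopman_aE koopman_tE /= chi_a// chi_t// conjcM !conjcK.
by ring.
Qed.

Lemma choose_small (K D a : R) : (0 <= K -> 0 <= D -> 0 < a ->
  exists2 e, 0 < e & K * (D * e) ^+ 2 < a)%R.
Proof.
move=> K0 D0 a0; pose L := (K * D ^+ 2)%R.
have L0 : (0 <= L)%R by rewrite mulr_ge0// sqr_ge0.
pose e := Num.min 1%R (a / (L + 1))%R.
have e0 : (0 < e)%R by rewrite lt_min ltr01 divr_gt0// ltr_wpDl.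
have e1 : (e <= 1)%R by rewrite ge_min lexx.
have eL : (e * (L + 1) <= a)%R by rewrite -ler_pdivlMr ?ltr_wpDl// ge_min lexx orbT.
exists e => //; rewrite exprMn mulrA -/L.
have : (L * e ^+ 2 <= L * e)%R by rewrite ler_wpM2l// expr2 ler_piMr// ltW.
lra.
Qed.

(** The span of [chi] and its conjugate is invariant under [A_pi z], which
    acts there by the matrix with diagonal entries z0, z0 and off-diagonal
    entries z1 v + z2, z1 w + z2, where v is the conjugate of w. Its
    determinant Q - 2 z1 z2 Re w becomes arbitrarily small while w runs
    through the roots of unity of order a power of 2, whereas a bounded
    inverse would bound the energy of f by a constant times the energy of
    [A_pi z f]. For z0 <> 0 this fails for the column of cofactors (z0, - (z1
    w + z2)), which is mapped to (det, 0); for z0 = 0 it fails for one of the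
    two basis vectors. *)
Lemma singular_on_conics (z : 'rV[C]_3) :
  on_spectral_conic z -> ~ invertible_operator mu (A_pi z).
Proof.
move=> [x x1 hx] [B [bB HB]].
have bA := bounded_A_pi mu_bernoulli z.
have [K K0 HK] := bounded_energy bB.
have below f : L2 mu f -> energy mu f <= K%:E * energy mu (A_pi z f).
  move=> fL; have AL := operator_L2 bA fL.
  have E : energy mu f = energy mu (B (A_pi z f)).
    apply: ae_eq_integral => //.
    - by apply: measurable_sqnorm; case/L2P: fL.
    - by apply: measurable_sqnorm; case/L2P: (operator_L2 bB AL).
    - have [_ /aeP] := HB f fL; apply: filterS => y Ey _.
      by rewrite /sqnorm Ey.
  by rewrite E; exact: HK.
pose D := normc (2 * (z 0 1 * z 0 2))%R.
have D0 : (0 <= D)%R by exact: normc_ge0.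
pose det w := (2 * (z 0 1 * z 0 2) * (x%:C - (complex.Re w)%:C)%C)%R.
have detE w : normc w = 1%R ->
    (z 0 0 ^+ 2 - (z 0 1 * (w^*)%C + z 0 2) * (z 0 1 * w + z 0 2) = det w)%R.
  move=> w1; have cw := normc_sq_conj w1; have aw := addcJ w.
  transitivity ((z 0 0 ^+ 2 - z 0 1 ^+ 2 - z 0 2 ^+ 2) +
      z 0 1 ^+ 2 * (1 - w * (w^*)%C) - z 0 1 * z 0 2 * (w + (w^*)%C))%R.
    by ring.
  by rewrite hx cw aw /det; ring.
have det_le w (e : R) : (`|complex.Re w - x| < e -> normc (det w) <= D * e)%R.
  move=> h; rewrite normcM -/D ler_wpM2l// -(rmorphB (real_complex R)) normc_real.
  by rewrite distrC ltW.
have bound n w a b : (normc w = 1 -> w ^+ (2 ^ n) = 1 -> w ^+ 2 != 1 ->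
    normc a ^+ 2 + normc b ^+ 2 <=
    K * (normc (z 0 0 * a + (z 0 1 * (w^*)%C + z 0 2) * b) ^+ 2 +
         normc (z 0 0 * b + (z 0 1 * w + z 0 2) * a) ^+ 2))%R.
  move=> w1 wn w2.
  have fL : L2 mu (fun x : boundary => a * chi n w x + b * ((chi n w x)^*)%C)%R.
    apply/L2P; split; last by rewrite energy_chi_comb// ltry.
    apply: cmeasurable_lin; first exact: cmeasurable_chi.
    exact: cmeasurable_scale (cmeasurable_conj (cmeasurable_chi n w)).
  have := below _ fL; rewrite energy_chi_comb//.
  have -> : A_pi z (fun x : boundary => a * chi n w x + b * ((chi n w x)^*)%C)%R =
     (fun x => (z 0 0 * a + (z 0 1 * (w^*)%C + z 0 2) * b) * chi n w x +
       (z 0 0 * b + (z 0 1 * w + z 0 2) * a) * ((chi n w x)^*)%C)%R.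
    by apply/funext => y; exact: A_pi_chi.
  by rewrite energy_chi_comb// -EFinM lee_fin.
have n01 : (normc (0 : C) = 0)%R by exact: normc0.
have n11 : (normc (1 : C) = 1)%R by exact: normc1.
have [z0|z0] := eqVneq (z 0 0)%R 0%R.
  have [e e0 He] := choose_small (mulr_ge0 K0 K0) D0 (@ltr01 R).
  have [n [w [wn w2 wx]]] := dyadic_root_dense x1 e0.
  have w1 : normc w = 1%R by apply: (normc_root _ wn); rewrite expn_gt0.
  have := bound n w 0%R 1%R w1 wn w2; have := bound n w 1%R 0%R w1 wn w2.
  rewrite !(mulr0, mulr1, add0r, addr0) z0 n01 n11 expr0n/= expr1n !(addr0, add0r).
  have := detE w w1; rewrite z0 expr0n/= sub0r => dE.
  have := det_le w e wx; rewrite -dE normcN normcM.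
  move: (normc_ge0 (z 0 1 * (w^*)%C + z 0 2)%R) (normc_ge0 (z 0 1 * w + z 0 2)%R).
  move: (normc (z 0 1 * (w^*)%C + z 0 2)%R) (normc (z 0 1 * w + z 0 2)%R).
  move=> s t s0 t0 st h1 h2.
  have h3 : (1 * 1 <= K * t ^+ 2 * (K * s ^+ 2))%R by rewrite ler_pM.
  have h4 : ((s * t) ^+ 2 <= (D * e) ^+ 2)%R.
    by rewrite lerXn2r ?nnegrE ?mulr_ge0// ltW.
  have h5 : (K * K * (s * t) ^+ 2 <= K * K * (D * e) ^+ 2)%R.
    by rewrite ler_wpM2l// mulr_ge0.
  have h6 : (K * t ^+ 2 * (K * s ^+ 2) = K * K * (s * t) ^+ 2)%R by ring.
  lra.
have [e e0 He] := choose_small K0 D0 (exprn_gt0 2 (normc_gt0 z0)).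
have [n [w [wn w2 wx]]] := dyadic_root_dense x1 e0.
have w1 : normc w = 1%R by apply: (normc_root _ wn); rewrite expn_gt0.
have := bound n w (z 0%R 0%R) (- (z 0 1 * w + z 0 2))%R w1 wn w2.
have -> : (z 0 0 * - (z 0 1 * w + z 0 2) + (z 0 1 * w + z 0 2) * z 0 0 = 0)%R by ring.
rewrite mulrN -expr2 detE// n01 expr0n/= addr0 => h.
have h0 := sqr_ge0 (normc (- (z 0 1 * w + z 0 2))%R).
have h1 : (K * normc (det w) ^+ 2 <= K * (D * e) ^+ 2)%R.
  by rewrite ler_wpM2l// lerXn2r ?nnegrE ?normc_ge0 ?mulr_ge0 ?(ltW e0)// det_le.
lra.
Qed.

End Characters.

(** * The Julia set *)

Theorem mainTheorem1 (R : realType) (mu : probability boundary R)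
    (mu_bernoulli : uniform_bernoulli mu) :
  julia_set R = proj_spectrum mu `|` ext_indet R.
Proof.
apply/seteqP; split=> p.
  move=> nF; have [pE|pE] := pselect (ext_indet R p); [by right|left].
  move=> inv; apply: nF; apply: (fatou_off_spectrum (coords_hcoord p)) => // S.
  exact: (singular_on_conics mu_bernoulli S inv).
have [pE _ [nE _]|pE [nI|//]] := pselect (ext_indet R p); first exact: nE.
apply: (not_fatou_on_spectrum (coords_hcoord p)) => //; apply: contrapT => nS.
by apply: nI; exact: invertible_off_conics.
Qed.
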